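(* Let $p\ge 3$ be a prime number and let $G=(V,E)$ be a $(6p-8)(p-1)$-edge-connected graph. For any mapping $f:E\to\mathbb{Z}_p\setminus\{0\}$ and any $\mathbb{Z}_p$-boundary $\beta$ of $G$, the graph $G$ has an $f$-weighted $\beta$-orientation.
   Context: Graphs are finite and may have multiple edges but no loops. A $\mathbb{Z}_k$-boundary of $G=(V,E)$ is a map $\beta:V\to\mathbb{Z}_k$ with $\sum_{v\in V}\beta(v)\equiv 0\pmod k$. An orientation $\vec G$ of $G$ gives each edge a direction; for $v\in V$, $\delta^+_{\vec G}(v)$ (resp. $\delta^-_{\vec G}(v)$) is the set of arcs leaving (resp. entering) $v$. Given $f:E\to\mathbb{Z}_k$, write $\partial f(v)=\sum_{\vec e\in\delta^+_{\vec G}(v)}f(e)-\sum_{\vec e\in\delta^-_{\vec G}(v)}f(e)$. An orientation $\vec G$ is an $f$-weighted $\beta$-orientation if $\partial f(v)\equiv\beta(v)\pmod k$ for every $v\in V$. *)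

(* Defs.v *)
From HB Require Import structures.
From mathcomp Require Import all_boot all_order all_algebra.
Set Implicit Arguments. Unset Strict Implicit. Unset Printing Implicit Defensive.
Import GRing.Theory.
Local Open Scope ring_scope.

(* A finite multigraph without loops: vertex type V, edge type E, each edge e
   has two (distinct) endpoints [end1 e] and [end2 e]; parallel edges allowed. *)
Definition loopless (V E : finType) (end1 end2 : E -> V) : Prop :=
  forall e, end1 e != end2 e.

Definition edge_cut (V E : finType) (end1 end2 : E -> V) (S : {set V}) : {set E} :=
  [set e | (end1 e \in S) != (end2 e \in S)].

(* k-edge-connected: every cut [S, V\S] with S nonempty proper has >= k edges
   (equivalently, deleting fewer than k edges leaves the graph connected). *)
Definition k_edge_connected (V E : finType) (end1 end2 : E -> V) (k : nat) : Prop :=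
  forall S : {set V}, S != set0 -> S != setT -> (k <= #|edge_cut end1 end2 S|)%N.

Definition is_boundary (V : finType) (k : nat) (beta : V -> 'Z_k) : Prop :=
  \sum_(v : V) beta v = 0.

Definition tail (V E : finType) (end1 end2 : E -> V) (o : E -> bool) (e : E) : V :=
  if o e then end1 e else end2 e.
Definition head (V E : finType) (end1 end2 : E -> V) (o : E -> bool) (e : E) : V :=
  if o e then end2 e else end1 e.

Definition partial_f (V E : finType) (end1 end2 : E -> V) (o : E -> bool)
    (k : nat) (f : E -> 'Z_k) (v : V) : 'Z_k :=
  \sum_(e : E | tail end1 end2 o e == v) f e - \sum_(e : E | head end1 end2 o e == v) f e.

Definition weighted_orientation (V E : finType) (end1 end2 : E -> V) (o : E -> bool)
    (k : nat) (f : E -> 'Z_k) (beta : V -> 'Z_k) : Prop :=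
  forall v, partial_f end1 end2 o f v = beta v.

(* Main.v *)
(** Split the edges into the classes [{w, -w}] of their weights. One class has so
    many edges that a smallest vertex set [H] spanning more than
    [(6p-8)(|H|-1)] of them induces a [(6p-7)]-edge-connected graph in that class
    (Mader's argument). Contract [H], orient the quotient by induction, and correct
    the boundary inside [H] with the edges of the class, whose weights become [1]
    after division by [w].

    This leaves the unweighted problem: a graph whose cuts have at least [5h-2]
    edges has an orientation with any prescribed [out - in] modulo [q = 2h] that
    respects the parity of the degrees. It is solved by induction in the presence
    of one preoriented vertex, for graphs in which the degree of every vertex set
    is bounded below by a function of the sum of its labels. A set close to its
    bound is contracted, the quotient is oriented, and then the inside of the set,
    with the rest of the graph as preoriented vertex. If no set is close to its
    bound, then a vertex with zero label is removed by lifting its edges in pairs,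
    or an edge is oriented so that both ends get closer to zero. When all labels
    have the same sign, one vertex [x] is chosen to collect what the others have
    to send, with weaker bounds for the sets that contain [x]. *)
Require Import Defs.
From mathcomp Require Import all_boot all_order all_algebra.
From mathcomp Require Import zify ring.
Set Implicit Arguments. Unset Strict Implicit. Unset Printing Implicit Defensive.
Import Order.TTheory GRing.Theory Num.Theory.
Local Open Scope ring_scope.

(** * Boundaries of orientations *)

Section Boundaries.
Variables (T : finType) (R : zmodType) (X : Type) (ends : X -> T * T) (wt : X -> R).
Implicit Types (L : seq X) (b : {ffun T -> R}) (A : {set T}).

(** For a loop the two terms cancel, so the loops created by contraction may stay in the edge
    list. *)
Definition inc x : {ffun T -> R} :=
  [ffun v => wt x *+ (v == (ends x).1) - wt x *+ (v == (ends x).2)].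

(* Some orientation of the edges in [L] has boundary [b]. *)
Fixpoint ach L b : Prop :=
  if L is x :: L' then
    exists2 b', ach L' b' & b = b' + inc x \/ b = b' - inc x
  else b = 0.

Lemma ach_ex L : exists b, ach L b.
Proof.
elim: L => [|x L [b bP]]; first by exists 0.
by exists (b + inc x); exists b => //; left.
Qed.

Lemma ach_opp L b : ach L b -> ach L (- b).
Proof.
elim: L b => [|x L IH] b /=; first by move=> ->; rewrite oppr0.
case=> b' /IH b'P [] ->; exists (- b') => //.
  by right; rewrite opprD.
by left; rewrite opprB addrC.
Qed.

Lemma ach_split (P : pred X) L b : ach L b ->
  exists b1 b2, [/\ ach (filter P L) b1, ach (filter (predC P) L) b2 & b = b1 + b2].
Proof.
elim: L b => [|x L IH] b /=; first by move=> ->; exists 0, 0; rewrite addr0.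
case=> b' /IH[b1 [b2 [b1P b2P ->]]] bE.
case: (P x) => /=.
- case: bE => ->; [exists (b1 + inc x), b2 | exists (b1 - inc x), b2];
    split=> //; try by rewrite addrAC.
  + by exists b1 => //; left.
  + by exists b1 => //; right.
- case: bE => ->; [exists b1, (b2 + inc x) | exists b1, (b2 - inc x)];
    split=> //; try by rewrite addrA.
  + by exists b2 => //; left.
  + by exists b2 => //; right.
Qed.

Lemma ach_join (P : pred X) L b1 b2 :
  ach (filter P L) b1 -> ach (filter (predC P) L) b2 -> ach L (b1 + b2).
Proof.
elim: L b1 b2 => [|x L IH] b1 b2 /=; first by move=> -> ->; rewrite addr0.
case: (P x) => /=.
- case=> b' b'P bE b2P; exists (b' + b2); first exact: IH.
  by case: bE => ->; [left | right]; rewrite addrAC.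
- move=> b1P [b' b'P bE]; exists (b1 + b'); first exact: IH.
  by case: bE => ->; [left | right]; rewrite addrA.
Qed.

Lemma inc_sum x A : (ends x).1 \in A -> (ends x).2 \in A -> \sum_(v in A) inc x v = 0.
Proof.
move=> x1 x2.
have one u : u \in A -> \sum_(v in A) wt x *+ (v == u) = wt x.
  move=> uA; rewrite (bigD1 u) //= eqxx big1 ?addr0 // => v /andP[_ /negPf->].
  by rewrite mulr0n.
rewrite (eq_bigr (fun v => wt x *+ (v == (ends x).1) - wt x *+ (v == (ends x).2))).
  by rewrite sumrB !one // subrr.
by move=> v _; rewrite ffunE.
Qed.

Lemma ach_sum L b A : ach L b ->
  (forall x, List.In x L -> ((ends x).1 \in A) && ((ends x).2 \in A)) ->
  \sum_(v in A) b v = 0.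
Proof.
elim: L b => [|x L IH] b /=.
  by move=> -> _; rewrite big1 // => v _; rewrite ffunE.
case=> b' b'P bE LA; have /andP[x1 x2] := LA x (or_introl erefl).
have b'0 := IH _ b'P (fun y yL => LA y (or_intror yL)).
case: bE => ->.
  by under eq_bigr do rewrite ffunE; rewrite big_split /= b'0 inc_sum // addr0.
under eq_bigr do rewrite !ffunE; rewrite sumrB b'0 -[RHS]subr0; congr (_ - _).
by rewrite -[RHS](inc_sum x1 x2); apply: eq_bigr => v _; rewrite ffunE.
Qed.

Lemma ach_out L b A v : ach L b ->
  (forall x, List.In x L -> ((ends x).1 \in A) && ((ends x).2 \in A)) ->
  v \notin A -> b v = 0.
Proof.
move=> bP LA vA; elim: L b bP LA => [|x L IH] b /=; first by move=> -> _; rewrite ffunE.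
case=> b' b'P bE LA; have /andP[x1 x2] := LA x (or_introl erefl).
have b'0 := IH _ b'P (fun y yL => LA y (or_intror yL)).
have x0 : inc x v = 0.
  rewrite ffunE; have -> : (v == (ends x).1) = false.
    by apply: contraNF vA => /eqP->.
  have -> : (v == (ends x).2) = false by apply: contraNF vA => /eqP->.
  by rewrite !mulr0n subr0.
case: bE => ->; first by rewrite ffunE b'0 x0 addr0.
by move: x0; rewrite !ffunE => ->; rewrite b'0 subr0.
Qed.

End Boundaries.

Lemma ach_map (T : finType) (R : zmodType) (X Y : Type) (g : Y -> X)
    (ends : X -> T * T) (wt : X -> R) (L : seq Y) b :
  ach ends wt (map g L) b <-> ach (ends \o g) (wt \o g) L b.
Proof.
elim: L b => [|x L IH] b //=.
split; case=> b' /IH b'P bE; exists b' => //.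
Qed.

(* Orientations of a quotient multigraph lift: the edges are the same. *)
Lemma ach_quot (T : finType) (R : zmodType) (X : Type) (ends : X -> T * T)
    (wt : X -> R) (f : T -> T) (L : seq X) b :
  ach (fun x => (f (ends x).1, f (ends x).2)) wt L b ->
  exists2 b', ach ends wt L b' & forall w, b w = \sum_(v | f v == w) b' v.
Proof.
elim: L b => [|x L IH] b /=.
  move=> ->; exists 0 => // w; rewrite ffunE big1 // => v _; rewrite ffunE //.
case=> b1 /IH[b1' b1P b1E] bE.
have key w : \sum_(v | f v == w) inc ends wt x v =
    inc (fun x => (f (ends x).1, f (ends x).2)) wt x w.
  rewrite ffunE /= (eq_bigr (fun v => wt x *+ (v == (ends x).1) - wt x *+ (v == (ends x).2))).
    have one u : \sum_(v | f v == w) wt x *+ (v == u) = wt x *+ (w == f u).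
      rewrite eq_sym; case: eqP => [fu|fu].
        rewrite (bigD1 u) ?fu //= eqxx big1 ?addr0 // => v /andP[_ /negPf->].
        by rewrite mulr0n.
      rewrite big1 ?mulr0n // => v /eqP fv; case: eqP => [vu|_]; last by rewrite mulr0n.
      by case: fu; rewrite -vu.
    by rewrite sumrB !one.
  by move=> v _; rewrite ffunE.
case: bE => ->.
- exists (b1' + inc ends wt x); first by exists b1' => //; left.
  by move=> w; rewrite ffunE b1E -key -big_split; apply: eq_bigr => v _; rewrite [RHS]ffunE.
- exists (b1' - inc ends wt x); first by exists b1' => //; right.
  move=> w; rewrite ffunE b1E [X in _ + X]ffunE -key -sumrB.
  by apply: eq_bigr => v _; rewrite !ffunE.
Qed.

(** * Residues modulo [2h] *)

Lemma dvdz_opp (d z : int) : (d %| - z)%Z = (d %| z)%Z.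
Proof. by rewrite !dvdzE abszN. Qed.

Section Residues.
Variable h : nat.
Hypothesis h_ge3 : (3 <= h)%N.
Notation q := (h * 2)%N.

(** [um] is the residue in [[0, q)] and [tau] the distance to the nearest multiple of [q]. Both keep
    the parity of [z], since [q] is even. *)
Definition um (z : int) : nat := `|(z %% q%:Z)%Z|%N.
Definition tau (z : int) : nat := minn (um z) (q - um z).

Lemma tauE z : tau z = minn (um z) (q - um z).
Proof. by []. Qed.

Lemma umP z : exists t : int, z = t * q%:Z + (um z)%:Z.
Proof.
exists (z %/ q%:Z)%Z; rewrite /um {1}(divz_eq z q%:Z); congr (_ + _).
by rewrite gez0_abs // modz_ge0; lia.
Qed.

Lemma um_lt z : (um z < q)%N.
Proof. by have := ltz_pmod z (d := q%:Z); rewrite /um; have := modz_ge0 z (d := q%:Z); lia. Qed.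

Lemma umE (t : int) (r : nat) : (r < q)%N -> um (t * q%:Z + r%:Z) = r.
Proof. by move=> rq; rewrite /um modzMDl modz_small //; lia. Qed.

Lemma um_cong z z' : (q%:Z %| z - z')%Z -> um z = um z'.
Proof.
case/dvdzP => s sE; have [t tE] := umP z'.
have -> : z = (s + t) * q%:Z + (um z')%:Z by rewrite mulrDl -sE -addrA -tE subrK.
by rewrite umE // um_lt.
Qed.

Lemma um0P z : (q%:Z %| z)%Z = (um z == 0%N).
Proof.
apply/idP/eqP => [zd|z0].
  by have := @um_cong z 0; rewrite subr0 => ->; rewrite // /um mod0z.
by have [t ->] := umP z; rewrite z0 addr0 dvdz_mull.
Qed.

Lemma um_opp z : um (- z) = if um z == 0%N then 0%N else (q - um z)%N.
Proof.
have [t tE] := umP z; have lt := um_lt z; case: eqP => u0.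
  have -> : - z = (- t) * q%:Z + 0%:Z by rewrite tE u0; ring.
  by rewrite umE //; lia.
have -> : - z = (- t - 1) * q%:Z + (q - um z)%N%:Z.
  by rewrite {1}tE -subzn ?(ltnW lt) //; ring.
by rewrite umE //; lia.
Qed.

Lemma um_pred z : um (z - 1) = if um z == 0%N then q.-1 else (um z).-1.
Proof.
have [t tE] := umP z; have lt := um_lt z; case: eqP => u0.
  have -> : z - 1 = (t - 1) * q%:Z + q.-1%:Z.
    by rewrite {1}tE u0 predn_int; [ring | lia].
  by rewrite umE //; lia.
have -> : z - 1 = t * q%:Z + (um z).-1%:Z by rewrite {1}tE predn_int; [ring | lia].
by rewrite umE //; lia.
Qed.

Lemma um_succ z : um (z + 1) = if um z == q.-1 then 0%N else (um z).+1.
Proof.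
have := um_pred (z + 1); rewrite addrK => ->; have := um_lt (z + 1).
by case: (um (z + 1)) => [|u] /=; rewrite ?eqxx //; case: eqP; lia.
Qed.

Lemma odd_um z : odd (um z) = odd `|z|%N.
Proof. by have [t tE] := umP z; rewrite [in RHS]tE; lia. Qed.

Lemma odd_tau z : odd (tau z) = odd `|z|%N.
Proof. by rewrite -odd_um /tau; have := um_lt z; lia. Qed.

Lemma tau_cong z z' : (q%:Z %| z - z')%Z -> tau z = tau z'.
Proof. by rewrite /tau => /um_cong->. Qed.

Lemma tau_opp z : tau (- z) = tau z.
Proof. by rewrite /tau um_opp; have := um_lt z; case: eqP; lia. Qed.

Lemma tau_pred z : (tau (z - 1)%R <= (tau z).+1)%N.
Proof. by rewrite /tau um_pred; have := um_lt z; case: eqP; lia. Qed.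

Lemma tau_le z : (tau z <= h)%N.
Proof. by rewrite /tau; lia. Qed.

Lemma tau_le_um z : (tau z <= um z)%N.
Proof. by rewrite /tau; lia. Qed.

Lemma um_le_tau z : (um z <= q - tau z)%N.
Proof. by rewrite /tau; have := um_lt z; lia. Qed.

(** Modulo [q] the sum is [um z' - um (- z)]. This adds up the bounds of the collecting vertex and
    of a single other vertex. *)
Lemma tau_add z z' : (tau (z + z')%R <= um (- z)%R + um z')%N.
Proof.
have [t tE] := umP (- z); have [s sE] := umP z'.
set a := um (- z) in tE *; set b := um z' in sE *.
have zz : z + z' = (s - t) * q%:Z + (b%:Z - a%:Z) by rewrite sE -[z]opprK tE; ring.
have lta : (a < q)%N := um_lt _.
have ltb : (b < q)%N := um_lt _.
case: (leqP a b) => ab.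
  have -> : z + z' = (s - t) * q%:Z + (b - a)%N%:Z by rewrite zz -subzn.
  by rewrite /tau umE; lia.
have -> : z + z' = (s - t - 1) * q%:Z + (q - (a - b))%N%:Z.
  by rewrite zz -!subzn; [ring | lia | lia].
by rewrite /tau umE; lia.
Qed.

(* Lower bound for the degree of [A] when its labels sum to [z]. With [Some x]
   the vertex [x] absorbs the labels of all others. *)
Definition phi (T : finType) (md : option T) (A : {set T}) (z : int) : nat :=
  if md is Some x then
    if x \in A then (q + um (- z))%N else (q * 2 - 2 + um z)%N
  else (q * 2 - 2 + tau z)%N.

(** Degrees have this parity as well, so a degree below [phi + 2] is at most [phi]. *)
Lemma odd_phi (T : finType) (md : option T) A z : odd (phi md A z) = odd `|z|%N.
Proof.
rewrite /phi; case: md => [x|]; last by have := odd_tau z; lia.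
by case: ifP => _; [have := odd_um (- z); rewrite abszN | have := odd_um z]; lia.
Qed.

Lemma phi_cong (T : finType) (md : option T) A z z' :
  (q%:Z %| z - z')%Z -> phi md A z = phi md A z'.
Proof.
move=> zz; rewrite /phi (um_cong zz) (tau_cong zz); case: md => // x.
by rewrite (@um_cong (- z) (- z')) // -opprD dvdz_opp.
Qed.

End Residues.

(** * Preoriented half-edges, degrees and reductions *)

Section Graphs.
Variables (h : nat) (T : finType).
Notation q := (h * 2)%N.
Implicit Types (E : seq (T * T)) (Z : seq (T * bool)) (A B S X : {set T}).
Implicit Types (l : T -> int) (b : {ffun T -> int}).

Definition oach E b := ach (fun e : T * T => e) (fun=> 1) E b.
Definition cut E A := count (fun e => (e.1 \in A) != (e.2 \in A)) E.
Definition zc Z A := count (fun z => z.1 \in A) Z.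
Definition dg E Z A := (cut E A + zc Z A)%N.
Definition eb E A B :=
  count (fun e => (e.1 \in A) && (e.2 \in B) || (e.1 \in B) && (e.2 \in A)) E.
Definition inS S E := all (fun e => (e.1 \in S) && (e.2 \in S)) E.
Definition inZ S Z := all (fun z => z.1 \in S) Z.
Definition sg (s : bool) : int := if s then 1 else -1.
(* [Z] lists the edges to an extra vertex outside the graph, whose orientation is
   fixed: [(v, true)] leaves [v]. *)
Definition zs Z v : int := \sum_(z <- Z) sg z.2 *+ (z.1 == v).
Definition lam l A : int := \sum_(v in A) l v.

(** The last two clauses are necessary for [sol]: out minus in has the parity of the degree, and the
    edges inside [S] cancel when boundaries are summed over [S]. *)
Definition ok S E Z l :=
  [/\ inS S E, inZ S Z,
      forall A, A \subset S -> odd `|lam l A| = odd (dg E Z A) &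
      (q%:Z %| lam l S - \sum_(v in S) zs Z v)%Z].

Definition sol S E Z l :=
  exists2 b, oach E b & forall v, v \in S -> (q%:Z %| b v + zs Z v - l v)%Z.

Lemma incE (e : T * T) v :
  inc (fun e : T * T => e) (fun=> 1 : int) e v = (v == e.1)%:Z - (v == e.2)%:Z :> int.
Proof. by rewrite ffunE; do 2!case: (_ == _). Qed.

Lemma sum_delta A (u : T) (c : int) : \sum_(v in A) c *+ (u == v) = c *+ (u \in A).
Proof.
case: (boolP (u \in A)) => uA.
  by rewrite (bigD1 u) //= eqxx big1 ?addr0 // => v /andP[_]; rewrite eq_sym => /negPf->.
rewrite big1 // => v vA; case: eqP => [uv|_] //.
by rewrite uv vA in uA.
Qed.

Lemma lamU l A B : [disjoint A & B] -> lam l (A :|: B) = lam l A + lam l B.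
Proof. by move=> dAB; rewrite /lam (eq_bigl [predU A & B]) ?bigU //= => v; rewrite !inE. Qed.

Lemma lam1 l v : lam l [set v] = l v.
Proof. by rewrite /lam big_set1. Qed.

Lemma eq_lam l l' A : {in A, l =1 l'} -> lam l A = lam l' A.
Proof. by move=> ll; apply: eq_bigr. Qed.

Lemma lam_shift l v A (c : int) :
  lam (fun u => l u + c *+ (v == u)) A = lam l A + c *+ (v \in A).
Proof. by rewrite /lam big_split sum_delta. Qed.

Lemma sum_zs Z A : \sum_(v in A) zs Z v = \sum_(z <- Z) sg z.2 *+ (z.1 \in A).
Proof.
rewrite exchange_big; apply: eq_bigr => z _; exact: sum_delta.
Qed.

Lemma zs_cat Z1 Z2 v : zs (Z1 ++ Z2) v = zs Z1 v + zs Z2 v.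
Proof. by rewrite /zs big_cat. Qed.

Lemma zs_cons z Z v : zs (z :: Z) v = sg z.2 *+ (z.1 == v) + zs Z v.
Proof. by rewrite /zs big_cons. Qed.

Lemma zs_perm Z1 Z2 v : perm_eq Z1 Z2 -> zs Z1 v = zs Z2 v.
Proof. exact: perm_big. Qed.

Lemma odd_zs Z v : odd `|zs Z v|%N = odd (zc Z [set v]).
Proof.
elim: Z => [|z Z IH]; first by rewrite /zs big_nil.
rewrite zs_cons /zc /= in_set1; move: IH; rewrite /zc.
by case: (z.1 == v); case: (z.2) => /=; lia.
Qed.

Lemma zs_le Z v : (`|zs Z v|%N <= zc Z [set v])%N.
Proof.
elim: Z => [|z Z IH]; first by rewrite /zs big_nil.
rewrite zs_cons /zc /= in_set1; move: IH; rewrite /zc.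
by case: (z.1 == v); case: (z.2) => /=; lia.
Qed.

Lemma dgU E Z A B : [disjoint A & B] ->
  (dg E Z (A :|: B) + 2 * eb E A B = dg E Z A + dg E Z B)%N.
Proof.
move=> dAB; have nAB v : ~~ ((v \in A) && (v \in B)).
  by apply/negP => /andP[vA]; rewrite (disjointFr dAB vA).
have zU : zc Z (A :|: B) = (zc Z A + zc Z B)%N.
  elim: Z => // z Z; rewrite /zc /= => ->; rewrite inE.
  by have := nAB z.1; do 2!case: (_ \in _); lia.
have cU : (cut E (A :|: B) + 2 * eb E A B = cut E A + cut E B)%N.
  elim: E => // e E; rewrite /cut /eb /= !inE.
  have := nAB e.1; have := nAB e.2.
  by do 4!case: (_ \in _) => //=; lia.
by rewrite /dg zU; lia.
Qed.

Lemma dg_all S E Z : inS S E -> inZ S Z -> dg E Z S = size Z.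
Proof.
move=> SE SZ; rewrite /dg /cut /zc.
rewrite (_ : count _ E = 0%N); last first.
  by apply/eqP; rewrite -leqn0 leqNgt -has_count -all_predC; apply: sub_all SE => e /andP[/= -> ->].
by apply/eqP; rewrite -all_count.
Qed.

Lemma dg0 E Z : dg E Z set0 = 0%N.
Proof.
rewrite /dg /cut /zc; elim: E => [|e E IH] /=; last by rewrite !inE.
by elim: Z => // z Z IH /=; rewrite inE.
Qed.

Lemma disjD A S : [disjoint A & S :\: A].
Proof. by rewrite -setI_eq0; apply/eqP/setP => v; rewrite !inE; case: (v \in A). Qed.

Lemma setUDs A S : A \subset S -> A :|: (S :\: A) = S.
Proof. by move=> /setIidPr AS; rewrite -[RHS](setID S A) AS. Qed.

Lemma dgD S E Z A : inS S E -> inZ S Z -> A \subset S ->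
  (size Z + 2 * eb E A (S :\: A) = dg E Z A + dg E Z (S :\: A))%N.
Proof.
move=> SE SZ AS; rewrite -(dg_all SE SZ) -(dgU _ _ (disjD A S)).
by rewrite setUDs.
Qed.

(** Records what is needed when edges are reordered or reversed in order to bring a chosen edge, in
    a chosen direction, to the head of the list. *)
Definition eqE E E' :=
  [/\ forall b, oach E' b -> oach E b, forall X, cut E X = cut E' X,
      size E = size E' & forall S, inS S E = inS S E'].

Lemma oach_swap e1 e2 E b : oach (e1 :: e2 :: E) b -> oach (e2 :: e1 :: E) b.
Proof.
rewrite /oach /=; set i1 := inc _ _ e1; set i2 := inc _ _ e2.
case=> b1 [b2 b2P b1E] bE; case: b1E bE => -> [] ->.
- by exists (b2 + i1); [exists b2 => //; left | left; rewrite addrAC].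
- by exists (b2 - i1); [exists b2 => //; right | left; rewrite addrAC].
- by exists (b2 + i1); [exists b2 => //; left | right; rewrite addrAC].
- by exists (b2 - i1); [exists b2 => //; right | right; rewrite addrAC].
Qed.

Lemma oach_flip (u v : T) E b : oach ((u, v) :: E) b -> oach ((v, u) :: E) b.
Proof.
have i : inc (fun e : T * T => e) (fun=> 1 : int) (u, v) = - inc (fun e : T * T => e) (fun=> 1) (v, u).
  by apply/ffunP => w; rewrite [RHS]ffunE !incE /= opprB.
rewrite /oach /=; case=> b' b'P bE; exists b' => //.
by case: bE => ->; rewrite i ?opprK; [right | left].
Qed.

Lemma edge_out E A B : (0 < eb E A B)%N ->
  exists y v E0, [/\ y \in A, v \in B & eqE E ((y, v) :: E0)].
Proof.
elim: E => // e E IH; rewrite /eb /=; case: (boolP (_ || _)) => [eAB _|_] /=; last first.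
  rewrite add0n => /IH[y [v [E0 [yA vB [ob oc os oS]]]]].
  exists y, v, (e :: E0); split=> //; split=> [b||| S] /=.
  - by move/oach_swap => [b' /ob b'P bE]; exists b'.
  - by move=> X; move: (oc X); rewrite /cut /= => ->; lia.
  - by rewrite os.
  - by move: (oS S); rewrite /inS /= => ->; rewrite andbCA.
case/orP: eAB => /andP[e1 e2].
  by exists e.1, e.2, E; split=> //; rewrite -surjective_pairing.
exists e.2, e.1, E; split=> //; split=> [b||| S] //.
- by move/oach_flip; rewrite -surjective_pairing.
- by move=> X; rewrite /cut /= eq_sym.
- by rewrite /inS /= (andbC (e.2 \in S)).
Qed.

Lemma z_out Z (z : T * bool) : z \in Z -> exists2 Z0, perm_eq Z (z :: Z0) & size Z = (size Z0).+1.
Proof.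
by move=> zZ; exists (rem z Z); rewrite ?perm_to_rem // size_rem // prednK //; case: Z zZ.
Qed.

Lemma cut_cons e E X : cut (e :: E) X = (((e.1 \in X) != (e.2 \in X)) + cut E X)%N.
Proof. by []. Qed.

Lemma zc_cons z Z X : zc (z :: Z) X = ((z.1 \in X) + zc Z X)%N.
Proof. by []. Qed.

Lemma zc_perm Z1 Z2 X : perm_eq Z1 Z2 -> zc Z1 X = zc Z2 X.
Proof. by move/permP; apply. Qed.

Lemma sol_eqE S E E' Z l : eqE E E' -> sol S E' Z l -> sol S E Z l.
Proof. by case=> oE _ _ _ [b /oE bP bS]; exists b. Qed.

Lemma sol_eqZ S E Z Z' l : perm_eq Z Z' -> sol S E Z' l -> sol S E Z l.
Proof. by move=> ZZ [b bP bS]; exists b => // v vS; rewrite (zs_perm v ZZ) bS. Qed.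

Lemma ok_eqE S E E' Z l : eqE E E' -> ok S E Z l -> ok S E' Z l.
Proof.
by case=> _ oc _ oS [SE SZ par sm]; split=> //; rewrite -?oS // => A AS; rewrite par // /dg oc.
Qed.

Lemma ok_eqZ S E Z Z' l : perm_eq Z Z' -> ok S E Z l -> ok S E Z' l.
Proof.
move=> ZZ [SE SZ par sm]; split=> //; first by rewrite /inZ -(perm_all _ ZZ).
  by move=> A AS; rewrite par // /dg (zc_perm _ ZZ).
by under eq_bigr do rewrite -(zs_perm _ ZZ).
Qed.

(** Reversing all edges and half-edges negates the labels. This turns residues above [h] into
    nonzero residues below [h]. *)
Lemma ok_neg S E Z l : ok S E Z l ->
  ok S E [seq (z.1, ~~ z.2) | z <- Z] (fun v => - l v).
Proof.
have ln A : lam (fun v => - l v) A = - lam l A by rewrite /lam sumrN.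
case=> SE SZ par sm; split=> //; first by rewrite /inZ all_map.
  by move=> A AS; rewrite ln abszN par // /dg /zc count_map.
rewrite ln (eq_bigr (fun v => - zs Z v)) => [|v _].
  by rewrite sumrN -opprD dvdz_opp.
by rewrite /zs big_map -sumrN; apply: eq_bigr => z _; rewrite -mulNrn; case: (z.2).
Qed.

Lemma sol_neg S E Z l :
  sol S E [seq (z.1, ~~ z.2) | z <- Z] (fun v => - l v) -> sol S E Z l.
Proof.
case=> b bP bS; exists (- b); first exact: ach_opp.
move=> v vS; have := bS v vS; rewrite ffunE.
have -> : zs [seq (z.1, ~~ z.2) | z <- Z] v = - zs Z v.
  by rewrite /zs big_map -sumrN; apply: eq_bigr => z _; rewrite -mulNrn; case: (z.2).
by rewrite -dvdz_opp; congr (_ %| _)%Z; ring.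
Qed.

(* Orient the edge from [y] to [x] and delete it. *)
Lemma sol_gift S E0 Z l y x :
  sol S E0 Z (fun u => l u - 1 *+ (y == u) + 1 *+ (x == u)) -> sol S ((y, x) :: E0) Z l.
Proof.
case=> b bP bS; exists (b + inc (fun e : T * T => e) (fun=> 1) (y, x)).
  by exists b => //; left.
move=> v vS; rewrite ffunE incE /=; have := bS v vS.
rewrite ![_ == v]eq_sym; congr (_ %| _)%Z.
by case: (v == y); case: (v == x) => /=; lia.
Qed.

Lemma lam_gift l y x A : lam (fun u => l u - 1 *+ (y == u) + 1 *+ (x == u)) A =
  lam l A - (y \in A)%:Z + (x \in A)%:Z.
Proof.
rewrite (lam_shift (fun u => l u - 1 *+ (y == u))); under eq_lam do rewrite -mulNrn.
by rewrite lam_shift; do 2!case: (_ \in A).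
Qed.

Lemma lam_zgift l v s A :
  lam (fun u => l u - sg s *+ (v == u)) A = lam l A - sg s *+ (v \in A).
Proof. by under eq_lam do rewrite -mulNrn; rewrite lam_shift mulNrn. Qed.

Lemma ok_gift S E0 Z l y x : y != x -> ok S ((y, x) :: E0) Z l ->
  ok S E0 Z (fun u => l u - 1 *+ (y == u) + 1 *+ (x == u)).
Proof.
move=> yx [/= /andP[/andP[/= yS xS] SE] SZ par sm].
split=> //; last by rewrite lam_gift yS xS subrK.
move=> A AS; have := par A AS; rewrite lam_gift /dg cut_cons /=.
by case: (y \in A); case: (x \in A) => /=; lia.
Qed.

Lemma sol_zgift S E Z0 l v s :
  sol S E Z0 (fun u => l u - sg s *+ (v == u)) -> sol S E ((v, s) :: Z0) l.
Proof.
case=> b bP bS; exists b => // u uS; have := bS u uS; rewrite zs_cons /=.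
by congr (_ %| _)%Z; ring.
Qed.

Lemma ok_zgift S E Z0 l v s : ok S E ((v, s) :: Z0) l ->
  ok S E Z0 (fun u => l u - sg s *+ (v == u)).
Proof.
move=> [SE /= /andP[/= vS SZ] par sm].
split=> //.
  move=> A AS; have := par A AS; rewrite lam_zgift /dg zc_cons /=.
  by case: (v \in A); case: (s) => /=; lia.
move: sm; rewrite lam_zgift vS !sum_zs big_cons /= vS; congr (_ %| _)%Z.
by rewrite !mulr1n; ring.
Qed.

(** The edge [s v] unfolds to a path through [y], which adds nothing to the boundary at [y]:
    [inc (s, v) = inc (y, v) - inc (y, s)]. *)
Lemma sol_lift S E0 Z l y s v :
  sol S ((s, v) :: E0) Z l -> sol S ((y, s) :: (y, v) :: E0) Z l.
Proof.
case=> b [b' b'P bE] bS; exists b => //.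
pose i u w : {ffun T -> int} := inc (fun e : T * T => e) (fun=> 1) (u, w).
have iE : i s v = i y v - i y s.
  by apply/ffunP => w; rewrite [RHS]ffunE [X in _ + X]ffunE !incE /=; ring.
rewrite -/(i s v) iE in bE.
case: bE => ->.
- by exists (b' + i y v); [exists b' => //; left | right; rewrite addrA].
- exists (b' - i y v); first by exists b' => //; right.
  by left; rewrite opprB addrCA addrC.
Qed.

(** The edge between [y] and [v] is directed so that it and the half-edge at [y] form a directed
    path through [y]. *)
Lemma sol_zlift S E0 Z0 l y v s :
  sol S E0 ((v, s) :: Z0) l -> sol S ((y, v) :: E0) ((y, s) :: Z0) l.
Proof.
case=> b bP bS; pose i : {ffun T -> int} := inc (fun e : T * T => e) (fun=> 1) (y, v).
exists (if s then b - i else b + i).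
  by exists b => //; case: (s); [right | left].
move=> u uS; have := bS u uS; rewrite !zs_cons /=; congr (_ %| _)%Z.
have -> : (if s then b - i else b + i) u = b u - sg s * i u.
  case: (s) => /=; rewrite ffunE; last by rewrite mulN1r opprK.
  by rewrite mul1r; congr (_ + _); rewrite ffunE.
by rewrite incE /= ![u == _]eq_sym; case: (s); case: (_ == u); case: (_ == u) => /=; ring.
Qed.

End Graphs.

(** * Contraction *)

Section Glue.
Variables (h : nat) (T : finType).
Hypothesis h_ge3 : (3 <= h)%N.
Notation q := (h * 2)%N.
Implicit Types (E : seq (T * T)) (Z : seq (T * bool)) (A B S X : {set T}).
Implicit Types (l : T -> int) (b : {ffun T -> int}).
Notation ok := (@ok h T).
Notation sol := (@sol h T).

Lemma all_In (X : Type) (P : pred X) (L : seq X) : all P L -> forall x, List.In x L -> P x.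
Proof.
elim: L => //= y L IH /andP[Py PL] x [<-|] //; exact: IH.
Qed.

Lemma oach_sum E b A : oach E b -> inS A E -> \sum_(v in A) b v = 0.
Proof. by move=> bP AE; apply: ach_sum bP (all_In AE). Qed.

Lemma oach_out E b A v : oach E b -> inS A E -> v \notin A -> b v = 0.
Proof. by move=> bP AE; apply: ach_out bP (all_In AE). Qed.

(* The congruence at the last vertex follows from the others by summation. *)
Lemma sol_last S E Z l x : ok S E Z l -> x \in S ->
  (exists2 b, oach E b & forall v, v \in S -> v != x -> (q%:Z %| b v + zs Z v - l v)%Z) ->
  sol S E Z l.
Proof.
move=> [SE SZ _ sm] xS [b bP bS]; exists b => // v vS.
case: (eqVneq v x) => [->|]; last exact: bS.
have tot : \sum_(v in S) (b v + zs Z v - l v) = - (lam l S - \sum_(v in S) zs Z v).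
  by rewrite sumrB big_split /= (oach_sum bP SE) add0r opprB.
move: sm; rewrite -dvdz_opp -tot (bigD1 x) //= => sm.
have rst : (q%:Z %| \sum_(v in S | v != x) (b v + zs Z v - l v))%Z.
  by apply: rpred_sum => u /andP[uS ux]; apply: bS.
by rewrite -(rpredDr _ rst).
Qed.

(** * Graphs with one or two vertices *)

Lemma sol1 E Z l v : ok [set v] E Z l -> sol [set v] E Z l.
Proof.
move=> okS; apply: (sol_last okS (set11 v)).
have [b bP] := ach_ex (fun e : T * T => e) (fun=> 1 : int) E.
by exists b => // u /set1P-> /eqP.
Qed.

Lemma cut_pair E x y : x != y -> inS [set x; y] E ->
  cut E [set y] = eb E [set x] [set y].
Proof.
move=> xy; elim: E => // e E IH /andP[/andP[e1 e2] /IH]; rewrite /cut /eb /= => ->.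
have yx : (y == x) = false by rewrite eq_sym (negPf xy).
move: e1 e2; rewrite !inE => /orP[] /eqP-> /orP[] /eqP->;
  by rewrite ?eqxx ?(negPf xy) ?yx.
Qed.

(** Let [j] of the edges between [x] and [y] leave [y] and the others enter it; loops add
    nothing. *)
Lemma oach_pair E x y j : x != y -> inS [set x; y] E ->
  (j <= eb E [set x] [set y])%N ->
  exists2 b, oach E b & b y = (2 * j)%N%:Z - (eb E [set x] [set y])%:Z.
Proof.
move=> xy; elim: E j => [|e E IH] j.
  by rewrite leqn0 => _ /eqP->; exists 0; rewrite ?ffunE.
move=> /andP[/andP[e1 e2] SE]; set f := eb E _ _ in IH *.
have fE : eb (e :: E) [set x] [set y] = ((e.1 != e.2) + f)%N.
  rewrite /eb /= -/(eb _ _ _) -/f; congr (nat_of_bool _ + _)%N.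
  have yx : (y == x) = false by rewrite eq_sym (negPf xy).
  by move: e1 e2; rewrite !inE => /orP[] /eqP-> /orP[] /eqP->; rewrite ?eqxx ?(negPf xy) ?yx.
rewrite fE => jf.
have [e12|ne12] := eqVneq e.1 e.2.
  rewrite e12 eqxx /= add0n in jf *.
  have [b bP bE] := IH j SE jf; exists (b + inc (fun e : T * T => e) (fun=> 1) e).
    by exists b => //; left.
  by rewrite ffunE incE e12 subrr addr0.
rewrite (negPf ne12) /= in jf *.
have [yE|yE] : e = (x, y) \/ e = (y, x).
  rewrite (surjective_pairing e).
  move: e1 e2 ne12; rewrite !inE => /orP[] /eqP-> /orP[] /eqP->; rewrite ?eqxx //; by [left | right].
- case: (leqP j f) => jf'.
    have [b bP bE] := IH j SE jf'; exists (b + inc (fun e : T * T => e) (fun=> 1) e).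
      by exists b => //; left.
    by rewrite ffunE incE yE /= eqxx [y == x]eq_sym (negPf xy) bE; lia.
  have [b bP bE] := IH j.-1 SE ltac:(lia); exists (b - inc (fun e : T * T => e) (fun=> 1) e).
    by exists b => //; right.
  by rewrite ffunE [X in _ + X]ffunE incE yE /= eqxx [y == x]eq_sym (negPf xy) bE; lia.
- case: (leqP j f) => jf'.
    have [b bP bE] := IH j SE jf'; exists (b - inc (fun e : T * T => e) (fun=> 1) e).
      by exists b => //; right.
    by rewrite ffunE [X in _ + X]ffunE incE yE /= eqxx [y == x]eq_sym (negPf xy) bE; lia.
  have [b bP bE] := IH j.-1 SE ltac:(lia); exists (b + inc (fun e : T * T => e) (fun=> 1) e).
    by exists b => //; left.
  by rewrite ffunE incE yE /= eqxx [y == x]eq_sym (negPf xy) bE; lia.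
Qed.

Lemma sol_pair E Z l x y j : x != y -> ok [set x; y] E Z l ->
  (j <= eb E [set x] [set y])%N ->
  (q%:Z %| (2 * j)%N%:Z - (eb E [set x] [set y])%:Z + zs Z y - l y)%Z ->
  sol [set x; y] E Z l.
Proof.
move=> xy okS jf qd; apply: (sol_last okS (set21 x y)).
have [SE _ _ _] := okS; have [b bP bE] := oach_pair xy SE jf.
exists b => // v /set2P[->|->]; first by rewrite eqxx.
by rewrite bE.
Qed.

Lemma pair_par E Z l x y : x != y -> ok [set x; y] E Z l ->
  odd `|l y|%N = odd (eb E [set x] [set y] + zc Z [set y]).
Proof.
move=> xy [SE SZ par _]; have := par [set y]; rewrite lam1 /dg (cut_pair xy SE); apply.
by rewrite sub1set set22.
Qed.

(** The degree condition says that the number [f] of edges between [x] and [y] is at least [h - 1].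
    Hence [2j - f] with [0 <= j < h] meets every residue modulo [2h] of the right parity. *)
Lemma sol_pair_univ E Z l x y : x != y -> ok [set x; y] E Z l ->
  (size Z + q <= dg E Z [set x] + dg E Z [set y] + 2)%N -> sol [set x; y] E Z l.
Proof.
move=> xy okS; have [SE SZ _ _] := okS; rewrite -dgU; last first.
  by rewrite disjoints1 inE.
rewrite (dg_all SE SZ); set f := eb _ _ _ => fh.
have par := pair_par xy okS; have zpar := odd_zs Z y; rewrite -/f in par.
pose m : int := ((l y - zs Z y + f%:Z)%R %/ 2)%Z.
have mE : l y - zs Z y + f%:Z = 2 * m.
  by rewrite /m; lia.
(* Taking [m] modulo [h] changes [2m - f] by a multiple of [q] only, and brings the number of edges
   leaving [y] into range. *)
pose j := `|(m %% h%:Z)%Z|%N.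
have m0 : (0 <= m %% h%:Z)%Z by rewrite modz_ge0; lia.
have mlt : (m %% h%:Z < h%:Z)%Z by apply: ltz_pmod; lia.
have jE : (j : int) = (m %% h%:Z)%Z by rewrite /j; lia.
apply: (sol_pair (j := j) xy okS); first by rewrite -/f; lia.
rewrite -/f; apply/dvdzP; exists (- (m %/ h%:Z)%Z).
have := divz_eq m h%:Z; rewrite -jE => mm.
rewrite (_ : _ - l y = 2 * j%:Z - 2 * m); last by rewrite -mE PoszM; ring.
by rewrite [in LHS]mm PoszM; ring.
Qed.

(** The condition on the degree of [x] says that [y] has at most as many half-edges as edges to [x].
    So these edges can cancel the half-edges at [y] exactly. *)
Lemma sol_pair_zero E Z l x y : x != y -> ok [set x; y] E Z l ->
  (q%:Z %| l y)%Z -> (size Z <= dg E Z [set x])%N -> sol [set x; y] E Z l.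
Proof.
move=> xy okS ql; have [SE SZ _ _] := okS => light.
have := dgU E Z (A := [set x]) (B := [set y]); rewrite disjoints1 inE xy => /(_ isT).
rewrite (dg_all SE SZ) [in dg _ _ [set y]]/dg (cut_pair xy SE).
set f := eb _ _ _ => dd; have zf : (zc Z [set y] <= f)%N by lia.
have par := pair_par xy okS; have zpar := odd_zs Z y; have zle := zs_le Z y.
rewrite -/f in par.
have ev : ~~ odd `|l y|%N.
  by case/dvdzP: ql => t ->; rewrite abszM absz_nat !oddM !andbF.
pose j := `|((f%:Z - zs Z y) %/ 2)%Z|%N.
apply: (sol_pair (j := j) xy okS); rewrite -/f; first by rewrite /j; lia.
rewrite (_ : _ - l y = - l y) ?dvdz_opp //.
by rewrite /j; lia.
Qed.

(** The contracted set [A] is represented by its element [a]: the quotient has vertex set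
    [a |: (S :\: A)] in the same type, the edges inside [A] become loops, and [pull] takes
    preimages. *)
Definition merge A (a : T) v := if v \in A then a else v.
Definition mergeE A a E := [seq (merge A a e.1, merge A a e.2) | e <- E].
Definition mergeZ A a Z := [seq (merge A a z.1, z.2) | z <- Z].
Definition mergel A a l v := if v == a then lam l A else l v.
Definition pull A (a : T) B : {set T} := if a \in B then B :|: A else B.
Definition inner A E := [seq e <- E | (e.1 \in A) && (e.2 \in A)].

Lemma merge_in A a B v : a \in A -> B \subset a |: ~: A ->
  (merge A a v \in B) = (v \in pull A a B).
Proof.
move=> aA /subsetP BA; rewrite /merge /pull; case: (boolP (v \in A)) => vA.
  case: (boolP (a \in B)) => aB; first by rewrite inE vA orbT.
  apply/esym; apply: contraNF aB => vB.
  by have := BA _ vB; rewrite !inE vA orbF => /eqP<-.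
by case: ifP => // _; rewrite inE (negPf vA) orbF.
Qed.

Lemma dg_merge A a B E Z : a \in A -> B \subset a |: ~: A ->
  dg (mergeE A a E) (mergeZ A a Z) B = dg E Z (pull A a B).
Proof.
move=> aA BA; rewrite /dg /cut /zc !count_map; congr (_ + _)%N; apply: eq_count => e /=;
  by rewrite !merge_in.
Qed.

Lemma lam_merge A a B l : a \in A -> B \subset a |: ~: A ->
  lam (mergel A a l) B = lam l (pull A a B).
Proof.
move=> aA BA; rewrite /pull; case: (boolP (a \in B)) => aB; last first.
  by apply: eq_lam => v vB; rewrite /mergel; case: eqP => // va; rewrite -va vB in aB.
have -> : B :|: A = A :|: B :\ a.
  by rewrite setUC; apply/setP => v; rewrite !inE; case: (eqVneq v a) => // ->; rewrite aA.
rewrite lamU; last first.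
  rewrite -setI_eq0; apply/eqP/setP => v; rewrite !inE; apply/negP => /and3P[vA va vB].
  by have := subsetP BA v vB; rewrite !inE (negPf va) vA.
rewrite {1}/lam (big_setD1 a) //= {1}/mergel eqxx; congr (_ + _).
by apply: eq_lam => v; rewrite !inE /mergel => /andP[/negPf->].
Qed.

Lemma sub_merge A a S : A \subset S -> a |: (S :\: A) \subset a |: ~: A.
Proof. by move=> AS; apply: setUS; rewrite setDE subsetIr. Qed.

Lemma ok_merge S E Z l A a : A \subset S -> a \in A -> ok S E Z l ->
  ok (a |: (S :\: A)) (mergeE A a E) (mergeZ A a Z) (mergel A a l).
Proof.
move=> AS aA [SE SZ par sm].
have mS v : v \in S -> merge A a v \in a |: (S :\: A).
  by rewrite /merge !inE; case: ifP; rewrite ?eqxx // => -> ->; rewrite orbT.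
have pS B : B \subset a |: (S :\: A) -> pull A a B \subset S.
  move=> /subsetP BS; apply/subsetP => v; rewrite /pull.
  have BS' : v \in B -> v \in S.
    by move/BS; rewrite !inE => /orP[/eqP->|/andP[_]] //; apply: (subsetP AS).
  by case: ifP => _ //; rewrite inE => /orP[//|]; apply: (subsetP AS).
have pSS : pull A a (a |: (S :\: A)) = S.
  rewrite /pull setU11 -setUA [_ :|: A]setUC setUDs //.
  by apply/setUidPr; rewrite sub1set (subsetP AS).
split.
- by rewrite /inS all_map; apply: sub_all SE => e /andP[e1 e2] /=; rewrite !mS.
- by rewrite /inZ all_map; apply: sub_all SZ => z z1 /=; rewrite mS.
- move=> B BS; have BA := subset_trans BS (sub_merge a AS).
  by rewrite lam_merge // dg_merge // par // pS.
- rewrite lam_merge ?sub_merge // pSS.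
  move: sm; rewrite !sum_zs /mergeZ big_map; congr (_ %| _ - _)%Z.
  rewrite [LHS]big_seq [RHS]big_seq; apply: eq_bigr => z zZ /=.
  by rewrite mS (allP SZ).
Qed.

(* The edges of [E] not inside [A], oriented with boundary [b], are seen from
   [A] as half-edges. *)
Lemma half_edges A E b : oach [seq e <- E | ~~ ((e.1 \in A) && (e.2 \in A))] b ->
  exists Zc, [/\ inZ A Zc, forall v, v \in A -> zs Zc v = b v,
    forall B, B \subset A -> (cut (inner A E) B + zc Zc B = cut E B)%N &
    (size (inner A E) + size Zc <= size E)%N].
Proof.
rewrite /inner; elim: E b => [|e E IH] b /=.
  move=> ->; exists [::]; split=> // v _; by rewrite /zs big_nil ffunE.
case: (boolP (e.1 \in A)) => e1 /=; case: (boolP (e.2 \in A)) => e2 /=.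
- move=> /IH[Zc [AZ Zb Zd Zs]]; exists Zc; split=> // B BA.
  by rewrite -(Zd B BA) addnA.
- case=> b' /IH[Zc [AZ Zb Zd Zs]] bE.
  exists ((e.1, if b == b' + inc (fun e : T * T => e) (fun=> 1) e then true else false) :: Zc).
  split=> /=; rewrite ?e1 //; last by lia.
    move=> v vA; rewrite zs_cons Zb //=.
    have ve2 : (v == e.2) = false by apply: contraNF e2 => /eqP<-.
    case: eqP => [->|bN]; first by rewrite ffunE incE ve2 subr0 eq_sym /=; case: (_ == _); lia.
    case: bE => // ->; rewrite ffunE [X in _ = _ + X]ffunE incE ve2 subr0 eq_sym /=.
    by case: (_ == _); lia.
  move=> B BA; rewrite -(Zd B BA) /zc /=.
  have -> : (e.2 \in B) = false by apply: contraNF e2 => /(subsetP BA).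
  by case: (e.1 \in B); lia.
- case=> b' /IH[Zc [AZ Zb Zd Zs]] bE.
  exists ((e.2, if b == b' + inc (fun e : T * T => e) (fun=> 1) e then false else true) :: Zc).
  split=> /=; rewrite ?e2 //; last by lia.
    move=> v vA; rewrite zs_cons Zb //=.
    have ve1 : (v == e.1) = false by apply: contraNF e1 => /eqP<-.
    case: eqP => [->|bN]; first by rewrite ffunE incE ve1 sub0r eq_sym /=; case: (_ == _); lia.
    case: bE => // ->; rewrite ffunE [X in _ = _ + X]ffunE incE ve1 sub0r opprK eq_sym /=.
    by case: (_ == _); lia.
  move=> B BA; rewrite -(Zd B BA) /zc /=.
  have -> : (e.1 \in B) = false by apply: contraNF e1 => /(subsetP BA).
  by case: (e.2 \in B); lia.
- case=> b' /IH[Zc [AZ Zb Zd Zs]] bE; exists Zc; split=> //; last by lia.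
    move=> v vA; rewrite Zb //.
    have ve1 : (v == e.1) = false by apply: contraNF e1 => /eqP<-.
    have ve2 : (v == e.2) = false by apply: contraNF e2 => /eqP<-.
    have i0 : inc (fun e : T * T => e) (fun=> 1) e v = 0 :> int by rewrite incE ve1 ve2.
    by case: bE => ->; rewrite ffunE ?i0 ?addr0 // [X in _ = _ + X]ffunE i0 subr0.
  move=> B BA; rewrite -(Zd B BA).
  have -> : (e.1 \in B) = false by apply: contraNF e1 => /(subsetP BA).
  by have -> : (e.2 \in B) = false by apply: contraNF e2 => /(subsetP BA).
Qed.

(** The edges that leave [A] keep their direction from the quotient and become half-edges of [A].
    Degrees of subsets of [A] do not change, and the inside of [A] is a separate instance. *)
Lemma glue S E Z l A a : ok S E Z l -> A \subset S -> a \in A ->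
  sol (a |: (S :\: A)) (mergeE A a E) (mergeZ A a Z) (mergel A a l) ->
  (forall Z', ok A (inner A E) Z' l ->
     (forall B, B \subset A -> dg (inner A E) Z' B = dg E Z B) ->
     (size (inner A E) + size Z' <= size E + size Z)%N ->
     sol A (inner A E) Z' l) ->
  sol S E Z l.
Proof.
move=> okS AS aA [bq bqP bqS] inn; have [SE SZ par sm] := okS.
move: bqP; rewrite /oach /mergeE ach_map => /ach_quot[b bP bE].
(* [b1] comes from the loops of the quotient and is replaced later by the solution inside [A]; [b2]
   is kept. *)
have [b1 [b2 [b1P b2P bb]]] := ach_split (fun e => (e.1 \in A) && (e.2 \in A)) bP.
have inA : inS A (inner A E) by rewrite /inS /inner all_filter; apply/allP => e _; apply/implyP.
have [Zc [AZ Zb Zd Zs]] := half_edges b2P.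
have zsA v : v \in A -> zs (filter (fun z => z.1 \in A) Z) v = zs Z v.
  move=> vA; rewrite /zs big_filter big_mkcond; apply: eq_bigr => z _.
  by case: ifP => // zA; case: eqP => // zv; rewrite zv vA in zA.
pose Z' := Zc ++ filter (fun z => z.1 \in A) Z.
have zsE v : v \in A -> zs Z' v = b2 v + zs Z v by move=> vA; rewrite zs_cat Zb // zsA.
have dgE B : B \subset A -> dg (inner A E) Z' B = dg E Z B.
  move=> BA; rewrite /dg /zc count_cat -[in RHS](Zd B BA) addnA; congr (_ + _)%N.
  rewrite count_filter; apply: eq_count => z /=.
  by case: (boolP (z.1 \in B)) => //= /(subsetP BA)->.
(* The congruence of the quotient at [a] is the sum condition of the instance inside [A]. *)
have sumA : (q%:Z %| lam l A - \sum_(v in A) zs Z' v)%Z.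
  have := bqS a (setU11 _ _); rewrite bE /mergel eqxx -dvdz_opp.
  rewrite (eq_bigl (fun v => v \in A)); last first.
    move=> v; rewrite /merge; case: ifP => vA; first by rewrite eqxx.
    by apply: contraFF vA => /eqP->.
  rewrite (eq_bigr (fun v => b2 v + zs Z v) (F1 := zs Z')); last by move=> v /zsE.
  rewrite big_split /= (eq_bigr (fun v => b1 v + b2 v)); last by move=> v _; rewrite bb ffunE.
  rewrite big_split /= (oach_sum b1P inA) add0r.
  have -> : zs (mergeZ A a Z) a = \sum_(v in A) zs Z v.
    rewrite sum_zs /zs big_map; apply: eq_bigr => z _ /=; congr (_ *+ nat_of_bool _).
    rewrite /merge; case: ifP => zA; first by rewrite eqxx.
    by apply: contraFF zA => /eqP->.
  by congr (_ %| _)%Z; ring.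
have [b1' b1P' b1S] : sol A (inner A E) Z' l.
  apply: inn => //; last by rewrite size_cat size_filter; have := count_size (fun z : T * bool => z.1 \in A) Z; lia.
  split=> //; first by rewrite /inZ all_cat -/(inZ A Zc) AZ all_filter; apply/allP => z _; apply/implyP.
  by move=> B BA; rewrite dgE // par // (subset_trans BA).
exists (b1' + b2); first exact: ach_join b1P' b2P.
move=> v vS; rewrite ffunE; case: (boolP (v \in A)) => vA.
  by have := b1S v vA; rewrite zsE //; congr (_ %| _)%Z; ring.
have va : (v == a) = false by apply: contraNF vA => /eqP->.
have := bqS v; rewrite !inE va vA vS => /(_ isT); rewrite /mergel va bE.
rewrite (eq_bigl (pred1 v)); last first.
  move=> u /=; rewrite /merge; case: ifP => // uA; rewrite eq_sym va.
  by apply/esym; apply: contraNF vA => /eqP<-.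
rewrite big_pred1_eq bb ffunE (oach_out b1P inA vA) (oach_out b1P' inA vA).
suff -> : zs (mergeZ A a Z) v = zs Z v by [].
rewrite /zs big_map; apply: eq_bigr => z _ /=; congr (_ *+ nat_of_bool _).
rewrite /merge; case: ifP => // zA; rewrite eq_sym va; apply/esym.
by apply: contraNF vA => /eqP<-.
Qed.

End Glue.

(** * The induction hypothesis *)

Section Hyp.
Variables (h : nat) (T : finType).
Hypothesis h_ge3 : (3 <= h)%N.
Notation q := (h * 2)%N.
Implicit Types (E : seq (T * T)) (Z : seq (T * bool)) (A B S : {set T}).
Implicit Types (l : T -> int) (md yo : option T).
Notation ok := (@ok h T).
Notation sol := (@sol h T).
Notation tau := (tau h).
Notation phi := (@phi h T).

(* The sets that must satisfy the lower bound; a zero vertex [y] and its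
   complement are exempt. *)
Definition free yo S A :=
  [&& A != set0, A != S & if yo is Some y then (A != [set y]) && (A != S :\ y) else true].

Definition ms S E Z := (#|S| + size E + size Z)%N.

(* [md = Some x] when [x] absorbs the labels of all others, [yo = Some y] while the
   vertex [y] with zero label is being lifted. *)
Definition Hyp md yo S E Z l :=
  [/\ ok S E Z l,
      forall A, A \subset S -> free yo S A -> (phi md A (lam l A) <= dg E Z A)%N,
      (size Z + tau (lam l S) + 2 <= q * 3)%N,
      (if md is Some x then x \in S /\ (size Z <= q * 2 + tau (lam l S))%N else True) &
      if yo is Some y
      then [/\ y \in S, md != Some y, (q%:Z %| l y)%Z & (size Z <= dg E Z (S :\ y))%N]
      else True].

Definition mdin md A := if md is Some x then if x \in A then Some x else None else None.

(** If the collector is not in [A], the subsets of [A] fall back on the symmetric bounds, which are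
    weaker because [tau <= um]. *)
Lemma phi_in md A B z : B \subset A -> (phi (mdin md A) B z <= phi md B z)%N.
Proof.
case: md => [x|] //= BA; case: ifP => //= xA; case: ifP => [/(subsetP BA)|_].
  by rewrite xA.
by rewrite leq_add2l tau_le_um.
Qed.

(** A set whose degree is at most [phi] thus meets the condition on [size Z] in [Hyp] when its
    inside is solved. *)
Lemma phi_bound md A z : (phi md A z + tau z + 2 <= q * 3)%N.
Proof.
have := um_le_tau h_ge3 z; have := um_le_tau h_ge3 (- z); have := tau_le h_ge3 z.
by rewrite tau_opp // /phi; case: md => [x|]; [case: ifP | ]; lia.
Qed.

Lemma phi_bound2 x A z : x \in A -> (phi (Some x) A z <= q * 2 + tau z)%N.
Proof. by move=> xA; rewrite /phi xA; have := um_lt h_ge3 (- z); lia. Qed.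

Lemma pullS A a S : A \subset S -> a \in A -> pull A a (a |: (S :\: A)) = S.
Proof.
move=> AS aA; rewrite /pull setU11 -setUA [_ :|: A]setUC setUDs //.
by apply/setUidPr; rewrite sub1set (subsetP AS).
Qed.

Lemma pullK A a B : a \in A -> B \subset a |: ~: A -> pull A a B :&: (a |: ~: A) = B.
Proof.
move=> aA BA; rewrite /pull; case: ifP => aB; last exact/setIidPl.
apply/setP => v; rewrite !inE; case: (eqVneq v a) => [->|va] /=; first by rewrite aB aA.
by case: (boolP (v \in A)) => vA; rewrite ?andbT ?andbF ?orbF //;
  apply/esym; apply: contraTF vA => /(subsetP BA); rewrite !inE (negPf va).
Qed.

Lemma pull_sub A a S B : A \subset S -> B \subset a |: (S :\: A) -> a \in A ->
  pull A a B \subset S.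
Proof.
move=> AS BS aA; rewrite -(pullS AS aA) /pull setU11; case: ifP => _.
  exact: setSU.
exact: subset_trans BS (subsetUl _ _).
Qed.

Lemma card_merge A a S : A \subset S -> a \in A ->
  (#|a |: (S :\: A)| + #|A| = #|S|.+1)%N.
Proof. by move=> AS aA; rewrite cardsU1 !inE aA cardsDS //=; move: (subset_leq_card AS); clear; lia. Qed.

Lemma phi_pull md A a B z : a \in A -> B \subset a |: ~: A ->
  (forall x, md = Some x -> x \in A -> a = x) ->
  phi md B z = phi md (pull A a B) z.
Proof.
move=> aA BA; rewrite /phi /pull; case: md => [x /(_ x erefl) xa|_] //.
case: (boolP (a \in B)) => aB //; rewrite inE.
by case: (boolP (x \in A)) => [/xa <-|]; rewrite ?aB ?orbF.
Qed.

Lemma quot_hyp md yo S E Z l A a : Hyp md yo S E Z l -> A \subset S -> a \in A ->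
  (1 < #|A|)%N -> (forall x, md = Some x -> x \in A -> a = x) ->
  Hyp md (if yo is Some y then if y \in A then None else Some y else None)
    (a |: (S :\: A)) (mergeE A a E) (mergeZ A a Z) (mergel A a l).
Proof.
move=> [okS fl c1 c4 cy] AS aA A1 mda.
have S'A := sub_merge a AS.
have S'l : lam (mergel A a l) (a |: (S :\: A)) = lam l S by rewrite lam_merge // pullS.
have sZ : size (mergeZ A a Z) = size Z by rewrite size_map.
have A0 w : A <> [set w] by move=> Aw; move: A1; rewrite Aw cards1.
split.
- exact: ok_merge.
- move=> B BS Bf; have BA := subset_trans BS S'A.
  rewrite lam_merge // dg_merge // (phi_pull _ aA BA mda); apply: fl.
    exact: pull_sub.
  case/and3P: Bf => B0 BnS By; rewrite /free; apply/and3P; split.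
  + apply: contraNneq B0 => p0; rewrite -(pullK aA BA) p0; by rewrite set0I.
  + apply: contraNneq BnS => pS; apply/eqP.
    by rewrite -(pullK aA BA) pS -[in LHS](pullS AS aA) pullK.
  + case: yo cy By => // y [yS mdy _ _] By; case: ifP By => yA.
      move=> _; apply/andP; split; apply/eqP => pE.
        move: pE; rewrite /pull; case: ifP => [aB pE|aB BE].
          have /subsetP sA : A \subset [set y] by rewrite -pE subsetUr.
          case: (A0 y); apply/eqP; rewrite eqEsubset; apply/andP; split; first exact/subsetP.
          by rewrite sub1set.
        have : y \in a |: ~: A by rewrite (subsetP BA) // BE set11.
        by rewrite !inE yA orbF => /eqP ya; rewrite BE ya set11 in aB.
      move: pE; rewrite /pull; case: ifP => [aB pE|aB BE].
        have : y \in B :|: A by rewrite inE yA orbT.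
        by rewrite pE !inE eqxx.
      have [v vA vy] : exists2 v, v \in A & v != y.
        case/card_gt1P: A1 => v [w [vA wA vw]]; case: (eqVneq v y) => [vy|]; last by exists v.
        by exists w => //; rewrite -vy eq_sym.
      have vB : v \in B by rewrite BE !inE vy (subsetP AS).
      have := subsetP BA v vB; rewrite !inE vA orbF => /eqP va.
      by rewrite -va vB in aB.
    case/andP=> By ByS; have ay : a != y by apply: contraFneq yA => <-.
    apply/andP; split; apply/eqP => pE.
      move: pE; rewrite /pull; case: ifP => [aB pE|aB BE].
        by have : a \in [set y]; [rewrite -pE inE aB | rewrite inE (negPf ay)].
      by rewrite BE eqxx in By.
    case/eqP: ByS; rewrite -(pullK aA BA) pE -{1}(pullS AS aA).
    rewrite -[in RHS](pullK aA S'A); apply/setP => v; rewrite !inE.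
    by case: (eqVneq v y) => //= ->; rewrite ?andbF.
- by rewrite sZ S'l.
- case: md c4 mda {fl cy} => // x [xS c4] mda; rewrite sZ S'l; split=> //.
  rewrite !inE xS andbT; case: (boolP (x \in A)) => xA; last by rewrite orbT.
  by rewrite (mda x erefl xA) eqxx.
- case: yo cy {fl} => // y [yS mdy qy lt]; case: ifP => // yA.
  have ay : a != y by apply: contraFneq yA => <-.
  have ya : y != a by rewrite eq_sym.
  split=> //.
  + by rewrite !inE yS yA orbT.
  + by rewrite /mergel (negPf ya).
  + rewrite sZ dg_merge //; last by apply: subset_trans S'A; apply: subsetDl.
    rewrite (_ : pull A a _ = S :\ y) // -[in RHS](pullS AS aA) /pull setU11 !inE ay eqxx /=.
    apply/setP => v; rewrite !inE; case: (eqVneq v y) => [->|] //=; by rewrite yA.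
Qed.

(** [A] has as many half-edges as its degree, so the conditions on [size Z'] become upper bounds for
    the degree of [A]. *)
Lemma inner_hyp md' yo' E Z A l Z' : ok A (inner A E) Z' l ->
  (forall B, B \subset A -> dg (inner A E) Z' B = dg E Z B) ->
  (forall B, B \subset A -> free yo' A B -> (phi md' B (lam l B) <= dg E Z B)%N) ->
  (dg E Z A + tau (lam l A) + 2 <= q * 3)%N ->
  (if md' is Some x then x \in A /\ (dg E Z A <= q * 2 + tau (lam l A))%N else True) ->
  (if yo' is Some y
   then [/\ y \in A, md' != Some y, (q%:Z %| l y)%Z & (dg E Z A <= dg E Z (A :\ y))%N]
   else True) ->
  Hyp md' yo' A (inner A E) Z' l.
Proof.
move=> okA dgE fl c1 c4 cy; have [AE AZ _ _] := okA.
have sZ : size Z' = dg E Z A by rewrite -dgE // dg_all.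
split=> //.
- by move=> B BA Bf; rewrite dgE // fl.
- by rewrite sZ.
- by move: c4; rewrite sZ.
- by case: yo' cy {fl} => // y []; rewrite sZ dgE // subsetDl.
Qed.

Definition IHyp N := forall md yo S E Z l, (ms S E Z < N)%N ->
  Hyp md yo S E Z l -> sol S E Z l.

(** The quotient has fewer vertices and is settled by induction. What remains is the inside, whose
    measure allows induction too. *)
Lemma glue_IH N md yo S E Z l A : IHyp N -> Hyp md yo S E Z l -> (ms S E Z <= N)%N ->
  A \subset S -> A != S -> (1 < #|A|)%N ->
  (forall Z', ok A (inner A E) Z' l ->
     (forall B, B \subset A -> dg (inner A E) Z' B = dg E Z B) ->
     (ms A (inner A E) Z' < N)%N -> sol A (inner A E) Z' l) ->
  sol S E Z l.
Proof.
move=> IH HS lN AS AnS A1 inn.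
have AltS : (#|A| < #|S|)%N by apply: proper_card; rewrite properEneq AnS.
have [a aA mda] : exists2 a, a \in A & forall x, md = Some x -> x \in A -> a = x.
  case: md {HS} => [x|]; last first.
    by have /card_gt0P[a aA] : (0 < #|A|)%N by [exact: ltnW]; exists a.
  case: (boolP (x \in A)) => xA; first by exists x => // w [].
  have /card_gt0P[a aA] : (0 < #|A|)%N by exact: ltnW.
  by exists a => // w [<-]; rewrite (negPf xA).
have HQ := quot_hyp HS AS aA A1 mda; have [okS _ _ _ _] := HS.
apply: (glue h_ge3 okS AS aA).
  apply: IH HQ; move: lN; rewrite /ms !size_map.
  by have := card_merge AS aA; lia.
move=> Z' okA dgE sz; apply: inn => //; move: lN sz; rewrite /ms; lia.
Qed.

End Hyp.

(** * Lifting at a vertex with zero label *)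

Section Lifting.
Variables (h : nat) (T : finType).
Implicit Types (E : seq (T * T)) (Z : seq (T * bool)) (A B S X : {set T}).
Implicit Types (l : T -> int) (md : option T).
Notation phi := (@phi h T).
Notation Hyp := (@Hyp h T).

Lemma eqE_cons e E E' : eqE E E' -> eqE (e :: E) (e :: E').
Proof.
case=> ob oc os oS; split=> /= [b||| S].
- by case=> b' /ob b'P bE; exists b'.
- by move=> X; rewrite oc.
- by rewrite os.
- by move: (oS S); rewrite /inS /= => ->.
Qed.

Lemma eqE_trans E1 E2 E3 : eqE E1 E2 -> eqE E2 E3 -> eqE E1 E3.
Proof.
case=> ob oc os oS [ob' oc' os' oS']; split=> [b||| S].
- by move/ob'/ob.
- by move=> X; rewrite oc.
- by rewrite os.
- by rewrite oS.
Qed.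

Lemma eb_eqE E E' A B : [disjoint A & B] -> eqE E E' -> eb E A B = eb E' A B.
Proof.
move=> dAB [_ oc _ _]; have := dgU E [::] dAB; have := dgU E' [::] dAB.
by rewrite /dg !oc /=; lia.
Qed.

Lemma ebU E A B (C : {set T}) : [disjoint A & B] -> [disjoint A & C] -> [disjoint B & C] ->
  eb E A (B :|: C) = (eb E A B + eb E A C)%N.
Proof.
move=> dAB dAC dBC; elim: E => // e E IH; move: IH; rewrite /eb /= !inE => ->.
have nd X (Y : {set T}) v : [disjoint X & Y] -> ~~ ((v \in X) && (v \in Y)).
  by move=> dXY; apply/negP => /andP[vX]; rewrite (disjointFr dXY vX).
have n1 := nd _ _ e.1 dAB; have n2 := nd _ _ e.2 dAB; have n3 := nd _ _ e.1 dAC.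
have n4 := nd _ _ e.2 dAC; have n5 := nd _ _ e.1 dBC; have n6 := nd _ _ e.2 dBC.
rewrite addnACA; congr (_ + _)%N; move: n1 n2 n3 n4 n5 n6.
by do 6!case: (_ \in _).
Qed.

Lemma cut_eb S E A : inS S E -> A \subset S -> cut E A = eb E A (S :\: A).
Proof.
move=> SE AS; have := dgD SE (Z := [::]) isT AS.
have := dgU E [::] (disjD A S); rewrite setUDs // /dg /= !addn0.
have -> : cut E S = 0%N by have := @dg_all _ S E [::] SE isT; rewrite /dg addn0.
have cc : cut E (S :\: A) = cut E A.
  elim: E SE => // e E IH /= /andP[/andP[e1 e2] /IH]; rewrite /cut /= => ->.
  by rewrite !inE e1 e2; do 2!case: (_ \in A).
by rewrite cc; lia.
Qed.

Lemma dg_zlift E0 Z0 (y v : T) s A : y != v ->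
  dg ((y, v) :: E0) ((y, s) :: Z0) A =
  (dg E0 ((v, s) :: Z0) A + 2 * ((y \in A) && (v \notin A)))%N.
Proof. by move=> yv; rewrite /dg cut_cons !zc_cons /=; case: (y \in A); case: (v \in A) => /=; lia. Qed.

Lemma dg_lift E0 Z (y s v : T) A :
  dg ((y, s) :: (y, v) :: E0) Z A = (dg ((s, v) :: E0) Z A +
  2 * (((y \in A) != (s \in A)) && ((y \in A) != (v \in A))))%N.
Proof.
by rewrite /dg !cut_cons /=; case: (y \in A); case: (v \in A); case: (s \in A) => /=; lia.
Qed.

(** Only a set with [y] inside and [v] outside loses degree, and it loses 2. *)
Lemma hyp_zlift md S E0 Z0 l y v s : y \in S -> v \in S -> y != v ->
  Hyp md (Some y) S ((y, v) :: E0) ((y, s) :: Z0) l ->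
  (forall A, A \subset S -> free (Some y) S A -> y \in A -> v \notin A ->
     (phi md A (lam l A) + 2 <= dg ((y, v) :: E0) ((y, s) :: Z0) A)%N) ->
  Hyp md (Some y) S E0 ((v, s) :: Z0) l.
Proof.
move=> yS vS yv [[SE SZ par sm] fl c1 c4 cy] nt.
have dE := dg_zlift E0 Z0 s _ yv; split=> //.
- split=> /=.
  + by case/andP: SE.
  + by rewrite vS; case/andP: SZ.
  + by move=> A AS; rewrite par // dE oddD mul2n odd_double addbF.
  + by move: sm; rewrite !sum_zs !big_cons /= yS vS.
- move=> A AS Af; have := fl A AS Af; have := nt A AS Af; rewrite dE.
  by case: (y \in A); case: (v \in A) => /= n; rewrite ?muln0 ?addn0 //; move: (n isT isT); rewrite leq_add2r.
- case: cy => _ mdy ql light; split=> //.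
  by move: light; rewrite dE !inE eqxx /= muln0 addn0.
Qed.

(** As no half-edge ends at [y], all of them count in the degree of [S :\ y], so [size Z] stays
    below that degree after the lift. *)
Lemma hyp_lift md S E0 Z l y s v : y \in S -> s \in S -> v \in S -> y != s -> y != v ->
  Hyp md (Some y) S ((y, s) :: (y, v) :: E0) Z l ->
  (forall A, A \subset S -> free (Some y) S A ->
     ((y \in A) != (s \in A)) && ((y \in A) != (v \in A)) ->
     (phi md A (lam l A) + 2 <= dg ((y, s) :: (y, v) :: E0) Z A)%N) ->
  ~~ has (fun z => z.1 == y) Z ->
  Hyp md (Some y) S ((s, v) :: E0) Z l.
Proof.
move=> yS sS vS ys yv [[SE SZ par sm] fl c1 c4 cy] nt nz.
have dE := dg_lift E0 Z y s v; split=> //.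
- split=> //=.
  + by rewrite sS vS; case/and3P: SE.
  + by move=> A AS; rewrite par // dE oddD mul2n odd_double addbF.
- move=> A AS Af; have := fl A AS Af; have := nt A AS Af; rewrite dE.
  by case: (_ && _) => /= [/(_ isT)|_]; rewrite ?muln0 ?addn0 // leq_add2r.
- case: cy => _ mdy ql light; split=> //.
  apply: (leq_trans _ (leq_addl _ _)); rewrite /zc.
  have /eqP -> // : count (fun z => z.1 \in S :\ y) Z == size Z.
  rewrite -all_count; apply/allP => z zZ; rewrite !inE (allP SZ) // andbT.
  by apply: contra nz => zy; apply/hasP; exists z.
Qed.

End Lifting.

(** * The induction step at a zero vertex *)

Section ZeroVertex.
Variables (h : nat) (T : finType).
Hypothesis h_ge3 : (3 <= h)%N.
Implicit Types (E : seq (T * T)) (Z : seq (T * bool)) (A B S X : {set T}).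
Implicit Types (l : T -> int) (md : option T).
Notation sol := (@sol h T).
Notation tau := (tau h).
Notation phi := (@phi h T).
Notation Hyp := (@Hyp h T).
Notation IHyp := (@IHyp h T).

(** [B] is contracted. The last condition is what the zero vertex [y] has to satisfy inside [B] if
    it belongs to [B]. *)
Lemma zstep_tight N md y S E Z l B : IHyp N -> (ms S E Z <= N)%N ->
  Hyp md (Some y) S E Z l -> B \subset S -> (1 < #|B :\ y|)%N -> B :\ y != S :\ y ->
  (dg E Z B < phi md B (lam l B) + 2)%N -> (dg E Z B <= dg E Z (B :\ y))%N ->
  sol S E Z l.
Proof.
move=> IH lN HS BS B1 BnD tight light.
have [[SE SZ par _] fl c1 c4 [yS mdy ql _]] := HS.
have BnS : B != S by apply: contraNneq BnD => ->.
have B1' : (1 < #|B|)%N by apply: leq_trans B1 _; rewrite subset_leq_card // subsetDl.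
have dgB : (dg E Z B <= phi md B (lam l B))%N.
  by have := par B BS; rewrite -(odd_phi h_ge3 md B); move: tight; clear; lia.
apply: (glue_IH h_ge3 IH HS lN BS BnS B1') => Z' okB dgE lB.
apply: IH lB _; apply: (@inner_hyp _ _ (mdin md B) (if y \in B then Some y else None) _ _ _ _ _ okB dgE).
- move=> C CB /and3P[C0 CnB Cy]; apply: leq_trans (phi_in h_ge3 _ _ CB) _.
  apply: fl; first exact: subset_trans BS.
  have CnS : C != S.
    by apply: contraNneq BnS => CS; rewrite eqEsubset BS -CS.
  have CnD : C != S :\ y.
    apply: contraNneq BnD => CD; rewrite eqEsubset setSD //= -CD.
    by apply/subsetP => v vC; rewrite !inE (subsetP CB) // andbT; move: vC; rewrite CD !inE => /andP[].
  rewrite /free C0 CnS CnD andbT /=; case: ifP Cy => [_ /andP[] //|yB _].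
  by apply: contraFneq yB => Cy; rewrite (subsetP CB) // Cy set11.
- by have := phi_bound h_ge3 md B (lam l B); move: dgB; clear; lia.
- move: dgB; rewrite /mdin; case: md {HS fl c4 mdy tight} => [x|] // dgB; case: ifP => // xB.
  by split=> //; apply: leq_trans dgB (phi_bound2 h_ge3 _ xB).
- case: ifP => // yB; split=> //.
  by case: md mdy {HS fl c4 tight dgB} => [x|] //=; case: ifP.
Qed.

(* Two edges of [y] with other ends [s] and [v] are replaced by an edge [s v]. Only
   a set which separates [y] from both loses degree, and it loses 2. *)
Lemma zstep N md y S E Z l : IHyp N -> (ms S E Z <= N)%N ->
  Hyp md (Some y) S E Z l -> sol S E Z l.
Proof.
move=> IH lN HS; have [okS fl c1 c4 [yS mdy ql light]] := HS.
have [SE SZ par sm] := okS.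
have ydS : [set y] \subset S by rewrite sub1set.
have yD : S = y |: S :\ y by rewrite setD1K.
(* [y] has zero label and is not the collector, so adding it to a set does not change the bound. *)
have phiU A : A \subset S -> phi md (y |: A) (lam l (y |: A)) = phi md (A :\ y) (lam l (A :\ y)).
  move=> AS; have -> : y |: A = y |: A :\ y.
    by apply/setP => v; rewrite !inE; case: (v == y).
  rewrite lamU ?lam1; last by rewrite disjoints1 !inE eqxx.
  rewrite (@phi_cong _ h_ge3 _ _ _ _ (lam l (A :\ y))) ?addrK //.
  rewrite /phi; case: md mdy {HS fl c4} => // x /eqP xy.
  by rewrite !inE; have -> : (x == y) = false by apply/eqP => e; case: xy; rewrite e.
have phiD A : A \subset S -> phi md A (lam l A) = phi md (A :\ y) (lam l (A :\ y)).
  move=> AS; case: (boolP (y \in A)) => yA.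
    by rewrite -(phiU A AS) (setUidPr _) // sub1set.
  by rewrite (setDidPl _) // disjoint_sym disjoints1.
case: (ltnP 1 #|S :\ y|) => D1; last first.
  case: (posnP #|S :\ y|) => D0.
    move/eqP: D0; rewrite cards_eq0 => /eqP D0; move: okS; rewrite yD D0 setU0; exact: sol1.
  have /cards1P[v Dv] : #|S :\ y| == 1%N by rewrite eqn_leq D1 D0.
  have vy : v != y by have := set11 v; rewrite -Dv !inE => /andP[].
  have Svy : S = [set v; y] by rewrite yD Dv setUC.
  move: okS light; rewrite Dv Svy => okS light; exact: sol_pair_zero.
have yebD : (0 < dg E Z [set y])%N -> (0 < eb E [set y] (S :\ y))%N.
  by have := dgD SE SZ ydS; move: light; clear; lia.
(* If [y] has degree zero, all other vertices are contracted to [a]; the quotient is a pair with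
   zero label at [y]. *)
case: (posnP (dg E Z [set y])) => y0.
  have [a aD mda] : exists2 a, a \in S :\ y & forall x, md = Some x -> a = x.
    case: md c4 mdy {HS fl phiU phiD} => [x [xS _]|_ _]; last first.
      by have /card_gt0P[a aD] := ltnW D1; exists a.
    move=> xy; exists x; last by move=> w [].
    rewrite !inE xS andbT; by apply: contraNneq xy => ->.
  have ay : a != y by move: aD; rewrite !inE => /andP[].
  have ya : y != a by rewrite eq_sym.
  have dgD' : dg E Z (S :\ y) = size Z.
    by have := dgD SE SZ ydS; move: y0; rewrite -(cut_eb SE ydS) /dg; clear; lia.
  have Q : a |: (S :\: (S :\ y)) = [set a; y].
    apply/setP => v; rewrite !inE; case: (eqVneq v a) => //= _.
    by case: (eqVneq v y) => [->|] //=; case: (v \in S).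
  apply: (glue h_ge3 okS (subsetDl _ _) aD).
    rewrite Q; apply: sol_pair_zero => //.
    - by rewrite -Q; apply: ok_merge => //; rewrite subsetDl.
    - by rewrite /mergel (negPf ya).
    - rewrite size_map dg_merge ?sub1set ?setU11 // (_ : pull _ _ _ = S :\ y) ?dgD' //.
      by rewrite /pull set11; apply/setUidPr; rewrite sub1set.
  move=> Z' okD dgE sz; apply: IH (_ : Hyp md None _ _ _ _).
    by move: lN sz; rewrite /ms [X in (X + _ + _)%N](cardsD1 y) yS; clear; lia.
  have tauD : tau (lam l (S :\ y)) = tau (lam l S).
    apply: tau_cong => //; rewrite [in X in _ - X]yD lamU ?lam1; last by rewrite disjoints1 !inE eqxx.
    by rewrite opprD addrCA subrr addr0 dvdz_opp.
  apply: (inner_hyp okD dgE) => //.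
  - move=> B BD /and3P[B0 BnD _]; apply: fl; first exact: subset_trans BD (subsetDl _ _).
    have yB : y \notin B by apply/negP => /(subsetP BD); rewrite !inE eqxx.
    rewrite /free B0 BnD !andbT /=; apply/andP; split; apply: contraNneq yB => ->; rewrite ?set11 //.
  - by rewrite dgD' tauD.
  - case: md c4 mda mdy {HS fl phiU phiD} => // x [xS c4] /(_ x erefl) ax _.
    by rewrite -ax dgD' tauD.
(* If [y] does not raise the degree of some [v], the pair is contracted, and inside it
   [sol_pair_zero] applies. *)
case: (boolP [exists v in S :\ y, (dg E Z [set v; y] <= dg E Z [set v])%N]).
  case/exists_inP => v vD lev; have := vD; rewrite !inE => /andP[vy vS].
  have AS : [set v; y] \subset S by apply/subsetP => u /set2P[] ->.
  have A2 : #|[set v; y]| = 2%N by rewrite cards2 vy.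
  have AnS : [set v; y] != S.
    apply/eqP => e; move: D1; have := cardsD1 y S; rewrite yS -e A2.
    by clear; lia.
  apply: (glue_IH h_ge3 IH HS lN AS AnS); first by rewrite A2.
  move=> Z' okA dgE _; apply: sol_pair_zero => //.
  have [AE AZ _ _] := okA.
  by rewrite -(dg_all AE AZ) !dgE // sub1set set21.
rewrite negb_exists_in => /forall_inP nm.
have {nm} m v : v \in S :\ y -> (dg E Z [set v] + 2 <= dg E Z [set v; y])%N.
  move=> vD; have := nm v vD; have := vD; rewrite !inE => /andP[vy vS].
  have AS : [set v; y] \subset S by apply/subsetP => u /set2P[] ->.
  have := par _ AS; have := par [set v]; rewrite sub1set => /(_ vS).
  rewrite lamU ?lam1; last by rewrite disjoints1 inE.
  have ev : ~~ odd `|l y|%N.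
    by case/dvdzP: ql => t ->; rewrite abszM absz_nat !oddM !andbF.
  by move: ev; clear; lia.
case: (boolP [exists A : {set T}, [&& A \subset S, (1 < #|A :\ y|)%N, A :\ y != S :\ y &
    (dg E Z A < phi md A (lam l A) + 2)%N]]).
  case/existsP => A /and4P[AS A1 AnD tA].
  have A2S : y |: A \subset S by rewrite subUset ydS.
  have A2D : (y |: A) :\ y = A :\ y by apply/setP => v; rewrite !inE; case: (v == y).
  have A1S : A :\ y \subset S by apply: subset_trans AS; apply: subsetDl.
  have A1D : (A :\ y) :\ y = A :\ y by apply/setP => v; rewrite !inE; case: (v == y).
  have AA : A = A :\ y \/ A = y |: A.
    case: (boolP (y \in A)) => yA; [right | left].
      by apply/esym/setUidPr; rewrite sub1set.
    by apply/esym/setDidPl; rewrite disjoint_sym disjoints1.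
  have pA := phiD A AS; have pA2 := phiU A AS.
  (* Both sets have the same bound; the one of smaller degree is contracted. *)
  case: (leqP (dg E Z (y |: A)) (dg E Z (A :\ y))) => le.
    apply: (zstep_tight IH lN HS A2S); rewrite ?A2D // pA2 -pA.
    by case: AA => e; [apply: leq_ltn_trans le _; rewrite -e | rewrite -e].
  apply: (zstep_tight IH lN HS A1S); rewrite ?A1D // -pA.
  case: AA => e; first by rewrite -e.
  by apply: ltn_trans le _; rewrite -e.
rewrite negb_exists => /forallP nt.
have {nt} G A : A \subset S -> free (Some y) S A -> (forall t, A <> [set t]) ->
    (phi md A (lam l A) + 2 <= dg E Z A)%N.
  move=> AS Af At; have /and3P[A0 AnS /andP[Any AnD]] := Af.
  case: (ltnP 1 #|A :\ y|) => A1.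
    have := nt A; rewrite AS A1 /=; case: eqP => /= [e _|_]; last by rewrite -leqNgt.
    case: (boolP (y \in A)) => yA.
      by case/eqP: AnS; rewrite yD -e setD1K.
    by case/eqP: AnD; rewrite -e; apply/esym/setDidPl; rewrite disjoint_sym disjoints1.
  case: (posnP #|A :\ y|) => A0'.
    move/eqP: A0'; rewrite cards_eq0 => /eqP A0'.
    case: (boolP (y \in A)) => yA.
      by case/eqP: Any; rewrite -(setD1K yA) A0' setU0.
    case/eqP: A0; rewrite -A0'; apply/esym/setDidPl; by rewrite disjoint_sym disjoints1.
  have /cards1P[t tE] : #|A :\ y| == 1%N by rewrite eqn_leq A1 A0'.
  have tD : t \in S :\ y.
    have : t \in A :\ y by rewrite tE set11.
    by rewrite !inE => /andP[-> /(subsetP AS)].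
  have yA : y \in A.
    apply: contra_notT (At t) => yA; rewrite -tE; apply/esym/setDidPl; by rewrite disjoint_sym disjoints1.
  have AE : A = [set t; y] by rewrite -(setD1K yA) tE setUC.
  rewrite phiD // tE AE; apply: leq_trans (m t tD); rewrite leq_add2r; apply: fl.
    by rewrite sub1set; move: tD; rewrite !inE => /andP[].
  rewrite /free; apply/and3P; split.
  - by apply/set0Pn; exists t; rewrite set11.
  - apply/eqP => e; move: D1; rewrite -e; have := subset_leq_card (subsetDl [set t] [set y]).
    by rewrite cards1; clear; lia.
  - apply/andP; split; apply/eqP => e; last by move: D1; rewrite -e cards1.
    by move: tD; rewrite !inE -in_set1 -e set11.
have ebD := yebD y0.
(* Half-edges at [y] are lifted first, each with an edge at [y]. *)
case: (boolP (has (fun z => z.1 == y) Z)) => hz.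
  case/hasP: hz => [[y' s]] zZ /= /eqP yy; rewrite {y'}yy in zZ.
  have [Z0 ZZ _] := z_out zZ.
  have [y' [v [E0 [/set1P-> vD EE]]]] := edge_out ebD.
  have [vy vS] : v != y /\ v \in S by move: vD; rewrite !inE => /andP[].
  have [_ oc os _] := EE; have sZ := perm_size ZZ.
  have dE A : dg ((y, v) :: E0) ((y, s) :: Z0) A = dg E Z A.
    by rewrite /dg oc (zc_perm _ ZZ).
  apply: (sol_eqE EE); apply: (sol_eqZ ZZ); apply: sol_zlift.
  apply: IH (_ : Hyp md (Some y) _ _ _ _); first by move: lN; rewrite /ms os sZ /=; clear; lia.
  apply: hyp_zlift => //; first by rewrite eq_sym.
    split=> //; first by apply: ok_eqZ ZZ _; apply: ok_eqE EE _.
    - by move=> A AS Af; rewrite dE fl.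
    - by rewrite -sZ.
    - by case: md c4 {HS fl mdy phiU phiD G} => // x; rewrite sZ.
    - by split=> //; rewrite dE -sZ.
  move=> A AS Af yA vA; rewrite dE; apply: G => // t At.
  by case/and3P: Af => _ _ /andP[/eqP[]]; rewrite At; move: yA; rewrite At => /set1P->.
have z0 : zc Z [set y] = 0%N.
  apply/eqP; rewrite -leqn0 leqNgt -has_count; apply: contra hz.
  by apply: sub_has => z; rewrite inE.
have [y' [s [Es [/set1P-> sD EEs]]]] := edge_out ebD.
have [sy sS] : s != y /\ s \in S by move: sD; rewrite !inE => /andP[].
have dys : [disjoint [set y] & [set s]] by rewrite disjoints1 inE eq_sym.
(* By [m], fewer than half of the edges at [y] go to [s], so there is a second neighbour [v]. With
   [v = s] the set [[set s]], which may have no slack, would lose degree. *)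
have eb2 : (0 < eb E [set y] (S :\ y :\ s))%N.
  have := dgU E Z dys; rewrite [_ :|: _]setUC => dd; have := m s sD.
  have ybs := cut_eb SE ydS.
  have ebs2 : eb E [set y] (S :\ y) = (eb E [set y] [set s] + eb E [set y] (S :\ y :\ s))%N.
    by rewrite -ebU ?setD1K // ?disjoints1 !inE ?eqxx ?andbF // eq_sym.
  by move: dd; rewrite [dg E Z [set y]]/dg z0 addn0 ybs ebs2; clear; lia.
have ebs : (0 < eb E [set y] [set s])%N.
  by rewrite (eb_eqE dys EEs) /eb /= !inE !eqxx.
have [y'' [v [E1 [/set1P-> vD EE1]]]] := edge_out eb2.
have [vs [vy vS]] : v != s /\ v != y /\ v \in S by move: vD; rewrite !inE => /and3P[].
have [y3 [s' [E0 [/set1P-> /set1P-> EE0]]]] : exists y3 s' E0,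
    [/\ y3 \in [set y], s' \in [set s] & eqE E1 ((y3, s') :: E0)].
  apply: edge_out; move: ebs; rewrite (eb_eqE dys EE1) /eb /= !inE.
  by rewrite [v == s](negPf vs) [y == s]eq_sym (negPf sy) andbF.
have EE := eqE_trans EE1 (eqE_cons (y, v) EE0).
have [_ oc os _] := EE.
have dE A : dg ((y, v) :: (y, s) :: E0) Z A = dg E Z A by rewrite /dg oc.
apply: (sol_eqE EE); apply: sol_lift.
apply: IH (_ : Hyp md (Some y) _ _ _ _); first by move: lN; rewrite /ms os /=; clear; lia.
apply: hyp_lift => //; rewrite 1?eq_sym //.
  split=> //; first by apply: ok_eqE EE _.
  - by move=> A AS Af; rewrite dE fl.
  - by split=> //; rewrite dE.
move=> A AS Af cond; rewrite dE; apply: G => // t At.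
move: cond; rewrite At !inE; case: (eqVneq y t) => [yt|yt].
  by case/and3P: Af => _ _ /andP[/eqP[]]; rewrite At yt.
by rewrite /= !negbK => /andP[/eqP vt /eqP st]; rewrite vt st eqxx in vs.
Qed.

End ZeroVertex.

(** * Sending everything to one vertex *)

Section Collector.
Variables (h : nat) (T : finType).
Hypothesis h_ge3 : (3 <= h)%N.
Notation q := (h * 2)%N.
Implicit Types (E : seq (T * T)) (Z : seq (T * bool)) (A B S X : {set T}).
Implicit Types (l : T -> int) (md yo : option T).
Notation sol := (@sol h T).
Notation um := (um h).
Notation tau := (tau h).
Notation phi := (@phi h T).
Notation Hyp := (@Hyp h T).
Notation IHyp := (@IHyp h T).

Lemma ebC E A B : eb E A B = eb E B A.
Proof. by apply: eq_count => e; rewrite orbC. Qed.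

Lemma lamD1 l S y : y \in S -> lam l S = l y + lam l (S :\ y).
Proof.
by move=> yS; rewrite -{1}(setD1K yS) lamU ?lam1 // disjoints1 !inE eqxx.
Qed.

Lemma lam_zero l S y : y \in S -> (q%:Z %| l y)%Z ->
  (q%:Z %| lam l S - lam l (S :\ y))%Z.
Proof. by move=> yS ql; rewrite (lamD1 _ yS) addrK. Qed.

(** The residue in [[1, q]]. When a set sends one unit, residue 0 turns into [q - 1], so it has to
    be counted as [q]. *)
Definition uh z := if um z == 0%N then q else um z.

Lemma uh_tau z : (uh z + tau z <= q)%N.
Proof.
rewrite /uh; case: eqP => u0; first by rewrite !tauE u0; clear; lia.
by have := um_le_tau h_ge3 z; have := um_lt h_ge3 z; rewrite !tauE; clear; lia.
Qed.

Lemma uh_ge z : (tau z <= uh z)%N.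
Proof.
by rewrite /uh; case: eqP => // u0; [have := tau_le h_ge3 z | have := tau_le_um h_ge3 z]; clear; lia.
Qed.

Lemma uh_gt0 z : (0 < uh z)%N.
Proof. by rewrite /uh; case: eqP; lia. Qed.

Lemma odd_uh z : odd (uh z) = odd `|z|%N.
Proof. by rewrite /uh -(odd_um h_ge3 z); case: eqP => // ->; rewrite oddM andbF. Qed.

Lemma free_sub S A B : B \subset A -> A \subset S -> A != S -> B != set0 -> free None S B.
Proof.
move=> BA AS AnS B0; rewrite /free B0 andbT /=.
by apply: contraNneq AnS => e; rewrite eqEsubset AS -e.
Qed.

(** A set that separates [x] from [y] loses one edge, and the residue in its bound drops by one
    unless it was 0. That case is covered by the strict [uh] bound, and for [[set x]] and [[set y]]
    it is excluded. *)
Lemma s1_gift S E0 Z l y x : y != x ->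
  Hyp (Some x) None S ((y, x) :: E0) Z l ->
  (0 < um (l y))%N -> (0 < um (- l x))%N ->
  (forall A, A \subset S -> A != S -> (1 < #|A|)%N ->
    ((if x \in A then q + uh (- lam l A)%R else q * 2 - 2 + uh (lam l A)) <
      dg ((y, x) :: E0) Z A)%N) ->
  Hyp (Some x) None S E0 Z (fun u => l u - 1 *+ (y == u) + 1 *+ (x == u)).
Proof.
move=> yx [okS fl c1 [xS c4] _] uy ux nt.
have [/= /andP[/andP[/= yS _] _] _ _ _] := okS.
have lS : lam (fun u => l u - 1 *+ (y == u) + 1 *+ (x == u)) S = lam l S.
  by rewrite lam_gift yS xS subrK.
split=> //; rewrite ?lS //; first exact: ok_gift.
move=> A AS Af; have flA := fl A AS Af; have ntA := nt A AS.
have dE : dg ((y, x) :: E0) Z A = (((y \in A) != (x \in A)) + dg E0 Z A)%N.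
  by rewrite /dg cut_cons /= addnA.
have A1 t : ~~ (1 < #|A|)%N -> t \in A -> A = [set t].
  by rewrite -leqNgt => A1 tA; apply/eqP; rewrite eq_sym eqEcard sub1set tA cards1.
rewrite lam_gift; move: flA ntA; rewrite dE /phi.
case: (boolP (y \in A)) => yA; case: (boolP (x \in A)) => xA /=.
- by rewrite subrK.
- move=> flA ntA; rewrite addr0 (um_pred h_ge3); move: flA ntA; rewrite /uh.
  case: (um (lam l A) =P 0%N) => u0; last by move=> + _; move: u0; clear; lia.
  move=> _ ntA; case: (ltnP 1 #|A|) => A2.
    by case/and3P: Af => _ AnS _; have := ntA AnS A2; move: h_ge3; clear; lia.
  by move: uy; rewrite -(lam1 l y) -(A1 y) ?u0 // -leqNgt.
- move=> flA ntA; rewrite subr0 (_ : - _ = - lam l A - 1); last by rewrite opprD.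
  rewrite (um_pred h_ge3); move: flA ntA; rewrite /uh.
  case: (um (- lam l A) =P 0%N) => u0; last by move=> + _; move: u0; clear; lia.
  move=> _ ntA; case: (ltnP 1 #|A|) => A2.
    by case/and3P: Af => _ AnS _; have := ntA AnS A2; move: h_ge3; clear; lia.
  by move: ux; rewrite -(lam1 l x) -(A1 x) ?u0 // -leqNgt.
- by rewrite subr0 addr0.
Qed.

(* Orient an edge towards [x] as long as its other end has a nonzero label; if [x]
   itself has label zero, return to the symmetric bounds. *)
Lemma s1_step N x S E Z l : IHyp N -> (ms S E Z <= N)%N ->
  Hyp (Some x) None S E Z l -> sol S E Z l.
Proof.
move=> IH lN HS; have [okS fl c1 [xS c4] _] := HS.
have [SE SZ par sm] := okS.
have xdS : [set x] \subset S by rewrite sub1set.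
case: (ltnP 1 #|S :\ x|) => D1; last first.
  case: (posnP #|S :\ x|) => D0.
    move/eqP: D0; rewrite cards_eq0 => /eqP D0.
    by move: okS; rewrite -(setD1K xS) D0 setU0; exact: sol1.
  have /cards1P[y Dy] : #|S :\ x| == 1%N by rewrite eqn_leq D1 D0.
  have yx : y != x by have := set11 y; rewrite -Dy !inE => /andP[].
  have xy : x != y by rewrite eq_sym.
  have Sxy : S = [set x; y] by rewrite -(setD1K xS) Dy.
  have fx : free None S [set x].
    rewrite /free andbT; apply/andP; split; first by apply/set0Pn; exists x; rewrite set11.
    by apply: contraNneq xy => e; have := set22 x y; rewrite -Sxy -e inE eq_sym.
  have fy : free None S [set y].
    rewrite /free andbT; apply/andP; split; first by apply/set0Pn; exists y; rewrite set11.
    by apply: contraNneq xy => e; have := set21 x y; rewrite -Sxy -e inE.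
  have yS : [set y] \subset S by rewrite sub1set Sxy set22.
  have := fl _ xdS fx; have := fl _ yS fy; rewrite /phi !inE eqxx (negPf xy) !lam1.
  (* By [tau_add] the two degrees sum to at least [3q - 2 + tau], which with [size Z <= 2q + tau] is
     what [sol_pair_univ] requires. *)
  move: c4; rewrite (lamD1 _ xS) Dy lam1; have := tau_add h_ge3 (l x) (l y).
  move=> ta c4 dy dx; move: okS; rewrite {1 2}Sxy => okS.
  by apply: (sol_pair_univ h_ge3 xy okS); move: ta c4 dy dx h_ge3; clear; lia.
(* A set within the [uh] bound is contracted; [uh + tau <= q] gives the conditions on its
   half-edges. *)
case: (boolP [exists A : {set T}, [&& A \subset S, A != S, (1 < #|A|)%N &
    (dg E Z A <= if x \in A then q + uh (- lam l A)%R else q * 2 - 2 + uh (lam l A))%N]]).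
  case/existsP => A /and4P[AS AnS A1 tA].
  apply: (glue_IH h_ge3 IH HS lN AS AnS A1) => Z' okA dgE lA.
  apply: IH lA _; apply: (inner_hyp (md' := mdin (Some x) A) (yo' := None) okA dgE) => //.
  - move=> B BA /and3P[B0 _ _]; apply: leq_trans (phi_in h_ge3 _ _ BA) _.
    by apply: fl; [apply: subset_trans AS | apply: free_sub AnS _].
  - move: tA; have := uh_tau (lam l A); have := uh_tau (- lam l A).
    by rewrite tau_opp //; case: ifP => _; move: h_ge3; clear; lia.
  - rewrite /mdin; case: ifP tA => // xA tA; split=> //.
    by move: tA; have := uh_tau (- lam l A); clear; lia.
rewrite negb_exists => /forallP nt.
have {nt} nt A : A \subset S -> A != S -> (1 < #|A|)%N ->
    ((if x \in A then q + uh (- lam l A)%R else q * 2 - 2 + uh (lam l A)) < dg E Z A)%N.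
  by move=> AS AnS A1; have := nt A; rewrite AS AnS A1 /= -ltnNge.
have DnS y : y \in S -> S :\ y != S.
  by move=> yS; apply: contraTneq yS => <-; rewrite !inE eqxx.
have cardD y : y \in S -> (1 < #|S :\ y|)%N.
  move=> yS; have := cardsD1 y S; have := cardsD1 x S; rewrite yS xS.
  by move: D1; clear; lia.
(* A collector with zero label becomes the zero vertex of the symmetric bounds. Sets containing it
   may violate these, and then a smallest violating set is contracted first. *)
case: (posnP (um (- l x))) => ux.
  have qlx : (q%:Z %| l x)%Z by rewrite -dvdz_opp (um0P h_ge3) ux.
  have tauD A : x \in A -> tau (lam l A) = tau (lam l (A :\ x)).
    by move=> xA; apply: tau_cong => //; apply: lam_zero.
  pose bad A := [&& A \subset S, x \in A, (1 < #|A|)%N, A != S &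
    (dg E Z A < q * 2 - 2 + tau (lam l A))%N].
  have good B : B \subset S -> B != set0 -> B != S -> B != [set x] -> ~~ bad B ->
      (phi None B (lam l B) <= dg E Z B)%N.
    move=> BS B0 BnS Bx nb; case: (boolP (x \in B)) => xB; last first.
      have Bf : free None S B by rewrite /free B0 BnS.
      apply: leq_trans (fl B BS Bf); rewrite /phi (negPf xB) leq_add2l.
      exact: tau_le_um.
    move: nb; rewrite /bad BS xB BnS /=; case: (ltnP 1 #|B|) => /= B1.
      by rewrite -leqNgt.
    move=> _.
    by case/eqP: Bx; apply/eqP; rewrite eq_sym eqEcard sub1set xB cards1.
  case: (boolP [exists A, bad A]) => [/existsP[A0 bA0]|].
    case: (arg_minnP (fun A : {set T} => #|A|) bA0) => A bA minA {A0 bA0}.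
    have /and5P[AS xA A1 AnS tA] := bA.
    apply: (glue_IH h_ge3 IH HS lN AS AnS A1) => Z' okA dgE lA.
    apply: IH lA _; apply: (inner_hyp (md' := None) (yo' := Some x) okA dgE) => //.
    - move=> B BA /and3P[B0 BnA /andP[Bx _]].
      have BS := subset_trans BA AS.
      apply: good => //; first by apply: contraNneq AnS => e; rewrite eqEsubset AS -e.
      by apply: contraNN BnA => bB; rewrite eqEcard BA minA.
    - by move: tA; have := tau_le h_ge3 (lam l A); move: h_ge3; clear; lia.
    (* The degree of [A] is below its symmetric bound, which equals that of [A :\ x] and so is at
       most the collector bound of [A :\ x]. *)
    - split=> //; apply: leq_trans (ltnW tA) _; rewrite tauD //.
      have A'0 : A :\ x != set0.
        by apply/eqP => e; move: A1; rewrite -(setD1K xA) e setU0 cards1.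
      have A'S : A :\ x \subset S by apply: subset_trans AS; apply: subsetDl.
      have A'f : free None S (A :\ x) by apply: free_sub AnS A'0; rewrite ?subsetDl.
      apply: leq_trans (fl _ A'S A'f); rewrite /phi !inE eqxx /= leq_add2l.
      exact: tau_le_um.
  rewrite negb_exists => /forallP nb.
  apply: (zstep h_ge3 (md := None) (y := x) IH lN); split=> //.
    by move=> B BS /and3P[B0 BnS /andP[Bx _]]; apply: good.
  (* By parity the degree of [S :\ x] exceeds [2q - 2 + uh] by at least 2, hence reaches [2q + tau],
     which bounds [size Z]. *)
  split=> //; have := nt _ (subsetDl S [set x]) (DnS x xS) D1; rewrite !inE eqxx /=.
  have := par _ (subsetDl S [set x]); have := odd_uh (lam l (S :\ x)).
  have := uh_ge (lam l (S :\ x)); move: c4; rewrite tauD //; move: h_ge3; clear; lia.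
have ebx : (0 < eb E (S :\ x) [set x])%N.
  rewrite ebC; have := dgD SE SZ xdS; have := nt _ (subsetDl S [set x]) (DnS x xS) D1.
  rewrite !inE eqxx /= => dD dd.
  have fx : free None S [set x].
    rewrite /free andbT; apply/andP; split; first by apply/set0Pn; exists x; rewrite set11.
    by apply: contraTneq D1 => <-; rewrite setDv cards0.
  have := fl _ xdS fx; rewrite /phi set11 => dx.
  have := uh_gt0 (lam l (S :\ x)); have := tau_le h_ge3 (lam l S).
  by move: dD dd dx c4 h_ge3; clear; lia.
have [y [x' [E0 [yD /set1P-> EE]]]] := edge_out ebx.
have [yx yS] : y != x /\ y \in S by move: yD; rewrite !inE => /andP[].
have [_ oc os _] := EE.
have dE A : dg ((y, x) :: E0) Z A = dg E Z A by rewrite /dg oc.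
case: (posnP (um (l y))) => uy; last first.
  apply: (sol_eqE EE); apply: sol_gift.
  apply: IH (_ : Hyp (Some x) None _ _ _ _); first by move: lN; rewrite /ms os /=; clear; lia.
  apply: s1_gift => //; last by move=> A AS AnS A1; rewrite dE nt.
  split=> //; first exact: ok_eqE EE _.
  by move=> A AS Af; rewrite dE fl.
(* The neighbour [y] has zero label. It is lifted if [S :\ y] has degree at least [size Z];
   otherwise [S :\ y] inherits the conditions on half-edges and is contracted, with the same
   collector. *)
have qly : (q%:Z %| l y)%Z by rewrite (um0P h_ge3) uy.
have xy : x != y by rewrite eq_sym.
have ydS : [set y] \subset S by rewrite sub1set.
case: (leqP (size Z) (dg E Z (S :\ y))) => light.
  apply: (zstep h_ge3 (md := Some x) (y := y) IH lN); split=> //.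
    by move=> B BS /and3P[B0 BnS _]; apply: fl; rewrite // /free B0 BnS.
have xD : x \in S :\ y by rewrite !inE xy.
have Q : x |: (S :\: (S :\ y)) = [set x; y].
  apply/setP => v; rewrite !inE; case: (eqVneq v x) => //= _.
  by case: (eqVneq v y) => [->|] //=; case: (v \in S).
have fD : free None S (S :\ y).
  rewrite /free DnS // !andbT; by apply/set0Pn; exists x.
have fy : free None S [set y].
  rewrite /free andbT; apply/andP; split; first by apply/set0Pn; exists y; rewrite set11.
  by apply: contraTneq xD => <-; rewrite setDv inE.
have tauD : tau (lam l (S :\ y)) = tau (lam l S).
  by apply/esym/tau_cong => //; apply: lam_zero.
apply: (glue h_ge3 okS (subsetDl _ _) xD).
  rewrite Q; apply: sol_pair_univ => //.
    by rewrite -Q; apply: ok_merge => //; rewrite subsetDl.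
  rewrite size_map !dg_merge ?sub1set ?setU11 //; last by rewrite !inE eqxx orbT.
  have -> : pull (S :\ y) x [set x] = S :\ y.
    by rewrite /pull set11; apply/setUidPr; rewrite sub1set.
  have -> : pull (S :\ y) x [set y] = [set y] by rewrite /pull inE (negPf xy).
  have := fl _ (subsetDl S [set y]) fD; have := fl _ ydS fy.
  rewrite /phi xD inE (negPf xy); have := tau_le_um h_ge3 (- lam l (S :\ y)).
  by rewrite tau_opp // tauD; move: c4 h_ge3; clear; lia.
move=> Z' okD dgE sz; apply: IH (_ : Hyp (Some x) None _ _ _ _).
  by move: lN sz; rewrite /ms [X in (X + _ + _)%N](cardsD1 y) yS; clear; lia.
apply: (inner_hyp (md' := Some x) (yo' := None) okD dgE) => //.
- move=> B BD /and3P[B0 BnD _].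
  have BS := subset_trans BD (subsetDl S [set y]).
  by apply: fl => //; apply: free_sub (DnS y yS) B0; rewrite ?subsetDl.
- by rewrite tauD; move: light c1; clear; lia.
- by split=> //; rewrite tauD; move: light c4; clear; lia.
Qed.

End Collector.

(** * Orientations with prescribed residues *)

Section Induction.
Variables (h : nat) (T : finType).
Hypothesis h_ge3 : (3 <= h)%N.
Notation q := (h * 2)%N.
Implicit Types (E : seq (T * T)) (Z : seq (T * bool)) (A B S : {set T}).
Implicit Types (l : T -> int) (md yo : option T).
Notation sol := (@sol h T).
Notation um := (um h).
Notation tau := (tau h).
Notation phi := (@phi h T).
Notation Hyp := (@Hyp h T).
Notation IHyp := (@IHyp h T).

(** The reverse inequality is the condition on [size Z] inside [A]; a set that satisfies it is
    contracted. *)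
Definition loose S E Z l := forall A, A \subset S -> A != S -> (1 < #|A|)%N ->
  (q * 3 < dg E Z A + tau (lam l A) + 2)%N.

Lemma free_cases yo S A : free yo S A ->
  (exists2 v, A = [set v] & A != S) \/ (A != S /\ 1 < #|A|)%N.
Proof.
case/and3P=> A0 AnS _; case: (ltnP 1 #|A|) => A1; first by right.
left; case/set0Pn: A0 => v vA; exists v => //.
by apply/eqP; rewrite eq_sym eqEcard sub1set vA cards1.
Qed.

Lemma single_free S v : v \in S -> (1 < #|S|)%N -> free None S [set v].
Proof.
move=> vS S1; rewrite /free andbT; apply/andP; split; first by apply/set0Pn; exists v; rewrite set11.
by apply: contraTneq S1 => <-; rewrite cards1.
Qed.

Lemma zs_false Z S : inZ S Z -> (forall z, z \in Z -> z.2 = false) ->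
  \sum_(v in S) zs Z v = - (size Z)%:Z.
Proof.
move=> ZS Zf; rewrite sum_zs; elim: Z ZS Zf => [|z Z IH] ZS Zf; first by rewrite big_nil.
case/andP: ZS => zS ZS; rewrite big_cons IH // => [|w wZ]; last by apply: Zf; rewrite inE wZ orbT.
by rewrite zS Zf ?mem_head //= mulr1n; lia.
Qed.

(** With all residues in [[1, h]] any vertex can be the collector, provided [size Z <= 2q + tau].
    With more half-edges, some half-edge is outgoing, and deleting it moves the label of its end
    towards zero. *)
Lemma s0_small N S E Z l : IHyp N -> (ms S E Z <= N)%N -> Hyp None None S E Z l ->
  loose S E Z l -> (1 < #|S|)%N -> (forall v, v \in S -> (0 < um (l v) <= h)%N) -> sol S E Z l.
Proof.
move=> IH lN HS nt S1 pos; have [okS fl c1 _ _] := HS; have [SE SZ par sm] := okS.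
case: (leqP (size Z) (q * 2 + tau (lam l S))) => zl.
  have /card_gt0P[x xS] : (0 < #|S|)%N by exact: ltnW.
  apply: (s1_step h_ge3 IH lN (x := x)); split=> // A AS Af.
  case: (free_cases Af) => [[v Av AnS]|[AnS A1]]; last first.
    have := nt A AS AnS A1; rewrite /phi.
    have := tau_le h_ge3 (lam l A); have := um_le_tau h_ge3 (lam l A); have := um_le_tau h_ge3 (- lam l A).
    rewrite tau_opp //; case: ifP => _; move: h_ge3; clear; lia.
  have := fl A AS Af; rewrite /phi Av lam1; rewrite Av sub1set in AS.
  have := pos v AS; rewrite !tauE um_opp // inE.
  by case: (x == v); case: (um (l v) =P 0%N) => // _; move: h_ge3; clear; lia.
(* Otherwise [q] divides [um (lam l S) + size Z], which is impossible for
   [2q + tau < size Z <= 3q - 2 - tau]. *)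
have [z zZ z2] : exists2 z, z \in Z & z.2.
  apply/hasP; rewrite -[has _ _]negbK -all_predC; apply/negP => /allP Zf.
  have Zf' z : z \in Z -> z.2 = false by move/Zf => /= /negbTE.
  move: sm; rewrite zs_false // opprK.
  have [t tE] := umP h_ge3 (lam l S); have lt := um_lt h_ge3 (lam l S).
  rewrite tE -addrA rpredDl ?dvdz_mull // -PoszD => dv.
  have {dv} : (q %| um (lam l S) + size Z)%N by [].
  case/dvdnP=> j jE; move: zl c1 lt; rewrite !tauE; move: jE h_ge3; clear.
  set u := um _; move: (size Z) => s jE h3 zl c1 lt.
  have [j2|[j3|j4]] : (j <= 2 \/ j = 3 \/ 4 <= j)%N by lia.
  - have : (j * q <= 2 * q)%N by rewrite leq_mul2r j2 orbT.
    by move: jE h3 zl c1 lt; clear; lia.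
  - by rewrite j3 in jE; move: jE h3 zl c1 lt; clear; lia.
  - have : (4 * q <= j * q)%N by rewrite leq_mul2r j4 orbT.
    by move: jE h3 zl c1 lt; clear; lia.
have [Z0 ZE sZ] := z_out zZ; case: z zZ z2 ZE => v [] //= zZ _ ZE.
have vS : v \in S by have := allP SZ _ zZ.
apply: (sol_eqZ ZE); apply: sol_zgift.
have dE A : dg E Z A = (dg E Z0 A + (v \in A))%N.
  by rewrite /dg (zc_perm _ ZE) zc_cons /= (addnC (v \in A)) addnA.
apply: IH (_ : Hyp None None _ _ _ _); first by move: lN; rewrite /ms sZ; clear; lia.
split=> //.
- by apply: ok_zgift (ok_eqZ ZE okS).
- move=> A AS Af; rewrite lam_zgift /=; have := fl A AS Af; rewrite dE.
  case: (boolP (v \in A)) => vA; last by rewrite mulr0n subr0 addn0.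
  rewrite mulr1n; case: (free_cases Af) => [[w Aw AnS]|[AnS A1]] /=.
    move: vA; rewrite Aw inE => /eqP<-; rewrite lam1.
    have := pos v vS; rewrite !tauE um_pred //.
    by case: eqP => // u0; move: h_ge3 u0; clear; lia.
  move=> _; have := nt A AS AnS A1; rewrite dE vA.
  move=> ntA; apply: leq_trans (_ : q * 2 - 2 + h <= _)%N; first by rewrite leq_add2l tau_le.
  by move: ntA (tau_le h_ge3 (lam l A)) h_ge3 => /=; move: (dg _ _ _) (tau _); clear; lia.
- rewrite lam_zgift vS mulr1n.
  have : (tau (lam l S - sg true)%R <= (tau (lam l S)).+1)%N := tau_pred h_ge3 _.
  by move: c1; rewrite sZ; clear; lia.
Qed.

Lemma s0_step N S E Z l : IHyp N -> (ms S E Z <= N)%N ->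
  Hyp None None S E Z l -> sol S E Z l.
Proof.
move=> IH lN HS; have [okS fl c1 _ _] := HS; have [SE SZ par sm] := okS.
case: (posnP #|S|) => S0.
  have [b bP] := ach_ex (fun e : T * T => e) (fun=> 1 : int) E.
  by exists b => // v vS; move: S0; rewrite (cardD1 v) vS.
case: (leqP #|S| 1) => S1.
  have /cards1P[v Sv] : #|S| == 1%N by rewrite eqn_leq S1 S0.
  by move: okS; rewrite Sv; exact: sol1.
case: (leqP #|S| 2) => S2.
  have /cards2P[x [y [xy Sxy]]] : #|S| == 2%N by rewrite eqn_leq S2 S1.
  have xS : x \in S by rewrite Sxy set21.
  have yS : y \in S by rewrite Sxy set22.
  have dx := fl [set x]; have dy := fl [set y].
  move: dx dy; rewrite !sub1set => /(_ xS (single_free xS S1)) + /(_ yS (single_free yS S1)).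
  rewrite /phi => dx dy; move: okS; rewrite {1 2}Sxy => okS.
  by apply: (sol_pair_univ h_ge3 xy okS); move: c1 dx dy h_ge3; clear; lia.
case: (boolP [exists A : {set T}, [&& A \subset S, A != S, (1 < #|A|)%N &
    (dg E Z A + tau (lam l A) + 2 <= q * 3)%N]]).
  case/existsP => A /and4P[AS AnS A1 tA].
  apply: (glue_IH h_ge3 IH HS lN AS AnS A1) => Z' okA dgE lA.
  apply: IH lA _; apply: (inner_hyp (md' := None) (yo' := None) okA dgE) => //.
  move=> B BA /and3P[B0 _ _].
  by apply: fl; [apply: subset_trans AS | apply: free_sub AnS _].
rewrite negb_exists => /forallP nt.
have {nt} nt : loose S E Z l.
  by move=> A AS AnS A1; have := nt A; rewrite AS AnS A1 /= -ltnNge.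
case: (boolP [exists y in S, um (l y) == 0%N]) => [/existsP[y /andP[yS uy]]|].
  have qly : (q%:Z %| l y)%Z by rewrite (um0P h_ge3) uy.
  apply: (zstep h_ge3 (md := None) (y := y) IH lN); split=> //.
    by move=> B BS /and3P[B0 BnS _]; apply: fl; rewrite // /free B0 BnS.
  split=> //.
  have DnS : S :\ y != S by apply: contraTneq yS => <-; rewrite !inE eqxx.
  have D1 : (1 < #|S :\ y|)%N by have := cardsD1 y S; rewrite yS; move: S2; clear; lia.
  (* [S :\ y] has the same [tau] as [S], so looseness puts its degree above [size Z]. *)
  have := nt _ (subsetDl S [set y]) DnS D1.
  rewrite (@tau_cong h h_ge3 _ (lam l S)) //; first by move: c1; clear; lia.
  by rewrite -opprB dvdz_opp; apply: lam_zero.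
rewrite negb_exists => /forallP nz.
have {nz} nz v : v \in S -> (0 < um (l v))%N.
  by move=> vS; have := nz v; rewrite vS /= lt0n.
(* Labels in [P] approach zero when lowered, the others when raised. If one side is empty,
   [s0_small] applies, after negation if [P] is empty. *)
pose P := [set v in S | (um (l v) <= h)%N].
have PS : P \subset S by apply/subsetP => v; rewrite inE => /andP[].
case: (eqVneq P S) => PeS.
  apply: (s0_small IH lN HS nt S1) => v vS; rewrite nz //=.
  by move: vS; rewrite -PeS inE => /andP[].
case: (eqVneq P set0) => P0.
  apply: sol_neg.
  have ln A : lam (fun v => - l v) A = - lam l A by rewrite /lam sumrN.
  have dE A : dg E [seq (z.1, ~~ z.2) | z <- Z] A = dg E Z A.
    by rewrite /dg /zc count_map.
  apply: (s0_small IH) => //.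
  - by rewrite /ms size_map.
  - split=> //; first exact: ok_neg.
      by move=> A AS Af; rewrite dE ln /phi tau_opp //; exact: fl.
    by rewrite size_map ln tau_opp.
  - by move=> A AS AnS A1; rewrite dE ln tau_opp //; exact: nt.
  - move=> v vS; have := nz v vS; have : v \notin P by rewrite P0 inE.
    rewrite inE vS /= -ltnNge um_opp //; have := um_lt h_ge3 (l v).
    by case: (um (l v) =P 0%N) => [->|_] //; clear; lia.
have PD : S :\: P != set0.
  by apply: contraNneq PeS => e; rewrite eqEsubset PS -setD_eq0 e eqxx.
have bnd A : A \subset S -> A != S -> A != set0 -> (q * 2 - 2 <= dg E Z A)%N.
  move=> AS AnS A0; apply: leq_trans (fl A AS _); first exact: leq_addr.
  by rewrite /free A0 AnS.
have DnS : S :\: P != S.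
  apply: contraNneq P0 => e; apply/eqP; move/setDidPl: e; rewrite disjoint_sym => /setDidPl <-.
  by apply/eqP; rewrite setD_eq0.
(* [P] and its complement have degree at least [2q - 2] each, more than [size Z] in total, so an
   edge joins them. *)
have ebx : (0 < eb E P (S :\: P))%N.
  have := dgD SE SZ PS; have := bnd P PS PeS P0.
  by have := bnd _ (subsetDl S P) DnS PD; move: c1 h_ge3; clear; lia.
have [y [x [E0 [yP xD EE]]]] := edge_out ebx.
have [_ oc os _] := EE.
have [xS xl] : x \in S /\ (h < um (l x))%N.
  by move: xD; rewrite !inE; case: (x \in S) => //=; rewrite andbT -ltnNge.
have [yS yl] : y \in S /\ (um (l y) <= h)%N by move: yP; rewrite inE => /andP[].
have yx : y != x by apply: contraTneq yl => ->; rewrite -ltnNge.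
have dE A : dg E Z A = (((y \in A) != (x \in A)) + dg E0 Z A)%N.
  by rewrite /dg oc cut_cons addnA.
apply: (sol_eqE EE); apply: sol_gift.
have lS : lam (fun u => l u - 1 *+ (y == u) + 1 *+ (x == u)) S = lam l S.
  by rewrite lam_gift yS xS subrK.
apply: IH (_ : Hyp None None _ _ _ _); first by move: lN; rewrite /ms os /=; clear; lia.
split; rewrite ?lS //; first by apply: ok_gift (ok_eqE EE okS).
move=> A AS Af; have := fl A AS Af; rewrite lam_gift dE /phi.
case: (free_cases Af) => [[v Av AnS]|[AnS A1]]; last first.
  move=> flA; have := nt A AS AnS A1; rewrite dE; move: flA.
  have := tau_le h_ge3 (lam l A).
  have := tau_le h_ge3 (lam l A - (y \in A)%:Z + (x \in A)%:Z).
  case: (y \in A); case: (x \in A) => /=; rewrite ?subrK ?subr0 ?addr0 //;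
    by move: h_ge3; clear; lia.
rewrite Av !inE lam1; case: (eqVneq y v) => [<-|yv] /=.
  rewrite [x == y]eq_sym (negPf yx) /= addr0; have := nz y yS.
  rewrite !tauE um_pred //; case: eqP => u0; first by rewrite u0.
  by move: h_ge3 u0 yl; clear; lia.
case: (eqVneq x v) => [<-|xv] /=; last by rewrite subr0 addr0.
rewrite subr0 !tauE um_succ //; have := um_lt h_ge3 (l x).
by case: eqP => u0; move: h_ge3 u0 xl; clear; lia.
Qed.

Lemma solve md yo S E Z l : Hyp md yo S E Z l -> sol S E Z l.
Proof.
suff all_hyp N : IHyp N by move=> HS; apply: (all_hyp _ _ _ _ _ _ _ (ltnSn _) HS).
elim: N => // N IH {}md {}yo {}S {}E {}Z {}l; rewrite ltnS => lN HS.
case: yo HS => [y|] HS; first exact: (zstep h_ge3 IH lN HS).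
by case: md HS => [x|] HS; [apply: (s1_step h_ge3 IH lN HS) | apply: (s0_step IH lN HS)].
Qed.

(** As [tau <= h], the symmetric bound is at most [2q - 2 + h = 5h - 2], so [solve] applies without
    half-edges. Parity at single vertices extends to all sets. *)
Lemma orient S E l : inS S E ->
  (forall A, A \subset S -> A != set0 -> A != S -> (h * 5 - 2 <= cut E A)%N) ->
  (forall v, v \in S -> odd `|l v| = odd (cut E [set v])) -> (q%:Z %| lam l S)%Z ->
  exists2 b, oach E b & forall v, v \in S -> (q%:Z %| b v - l v)%Z.
Proof.
move=> SE cuts par qS.
have dE A : dg E [::] A = cut E A by rewrite /dg addn0.
have parA A : A \subset S -> odd `|lam l A| = odd (dg E [::] A).
  elim: {A}_.+1 {-2}A (ltnSn #|A|) => // n IH A; rewrite ltnS => An AS.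
  case: (set_0Vmem A) => [->|[v vA]]; first by rewrite dg0 /lam big_set0.
  have vS := subsetP AS v vA; have dvA : [disjoint [set v] & A :\ v] by exact: disjD.
  rewrite (lamD1 _ vA); have := dgU E [::] dvA; rewrite setD1K // dE.
  have cA : (#|A :\ v| < n)%N by move: An; rewrite (cardsD1 v) vA.
  have := IH (A :\ v) cA (subset_trans (subsetDl _ _) AS); rewrite dE.
  by move: (par v vS); rewrite dE; clear; lia.
have [|b bP bS] := @solve None None S E [::] l.
- split=> //.
  + by split=> //; rewrite big1 ?subr0 // => v _; rewrite /zs big_nil.
  + move=> A AS /and3P[A0 AnS _]; rewrite dE; apply: leq_trans (cuts A AS A0 AnS).
    by rewrite /phi; have := tau_le h_ge3 (lam l A); move: h_ge3; clear; lia.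
  + by have := tau_le h_ge3 (lam l S); move: h_ge3 => /=; clear; lia.
by exists b => // v /bS; rewrite /zs big_nil addr0.
Qed.

End Induction.

(** * Weighted orientations *)

Section Weighted.
Variables (p : nat) (T : finType) (X : Type) (wt : X -> 'Z_p).
Hypotheses (p_pr : prime p) (p_ge3 : (3 <= p)%N).
Implicit Types (ends : X -> T * T) (L : seq X) (A S : {set T}) (P : pred X).

Lemma p_odd : odd p.
Proof. by case: (even_prime p_pr) p_ge3 => // ->. Qed.

Definition within ends A x := ((ends x).1 \in A) && ((ends x).2 \in A).

Lemma handshake ends L S : all (within ends S) L ->
  (\sum_(v in S) cut (map ends L) [set v] =
   2 * count (fun x => (ends x).1 != (ends x).2) L)%N.
Proof.
have one u : u \in S -> (\sum_(v in S) (u == v) = 1)%N.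
  move=> uS; rewrite (bigD1 u) //= eqxx big1 // => v /andP[_]; rewrite eq_sym.
  by move/negPf->.
elim: L => [|x L IH]; first by rewrite big1.
case/andP=> /andP[x1 x2] /IH {}IH.
under eq_bigr do rewrite map_cons cut_cons !inE.
rewrite /= big_split /= IH mulnDr; congr (_ + _)%N.
case: (eqVneq (ends x).1 (ends x).2) => [->|ne]; first by rewrite big1 // => v _; rewrite eqxx.
rewrite (eq_bigr (fun v => ((ends x).1 == v) + ((ends x).2 == v))%N); last first.
  move=> v _; case: ((ends x).1 =P v) ne => [->|_ _]; last by case: ((ends x).2 == v).
  by rewrite [(ends x).2 == v]eq_sym => /negPf->.
by rewrite big_split /= !one.
Qed.

(** An edge of weight [- w] acts as a reversed edge of weight [w]. *)
Lemma ach_scale ends L (w : 'Z_p) (b : {ffun T -> int}) :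
  all (fun x => (wt x == w) || (wt x == - w)) L ->
  oach (map ends L) b -> ach ends wt L [ffun v => w * (b v)%:~R].
Proof.
move=> Lw /ach_map; elim: L b Lw => [|x L IH] b /=.
  by move=> _ ->; apply/ffunP => v; rewrite !ffunE mulr0.
case/andP=> xw Lw [b' b'P bE]; exists [ffun v => w * (b' v)%:~R]; first exact: IH.
have scaleD (c : {ffun T -> int}) : [ffun v => w * ((b' + c) v)%:~R] =
    [ffun v => w * (b' v)%:~R] + [ffun v => w * (c v)%:~R] :> {ffun T -> 'Z_p}.
  by apply/ffunP => v; rewrite !ffunE rmorphD mulrDr.
have scaleN (c : {ffun T -> int}) :
    [ffun v => w * ((- c) v)%:~R] = - [ffun v => w * (c v)%:~R] :> {ffun T -> 'Z_p}.
  by apply/ffunP => v; rewrite !ffunE rmorphN mulrN.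
pose i := inc (ends \o id) (fun=> 1 : int) x.
have incS (u : 'Z_p) : inc ends (fun=> u) x = [ffun v => u * (i v)%:~R].
  by apply/ffunP => v; rewrite !ffunE rmorphB /= mulrBr; do 2!case: (_ == _);
     rewrite ?mulr1n ?mulr0n ?mulr1 ?mulr0.
have incx : inc ends wt x = inc ends (fun=> wt x) x by [].
rewrite incx incS; case/orP: xw => /eqP ->; case: bE => ->.
- by left; rewrite scaleD.
- by right; rewrite scaleD scaleN.
- right; rewrite scaleD; congr (_ + _); apply/ffunP => v; rewrite !ffunE; ring.
- left; rewrite scaleD scaleN; congr (_ + _); apply/ffunP => v; rewrite !ffunE; ring.
Qed.

(* As [p] is odd, this representative of [n] modulo [p] has the parity of [d]. *)
Definition par_shift (n d : nat) : int := (n + (if odd n == odd d then 0 else p))%N.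

(** The edges outside [P] are oriented arbitrarily. The rest of the target is divided by [w], lifted
    to integers of the right parity, and realised modulo [2p] by the edges in [P]. *)
Lemma weighted_orient ends L S P (w : 'Z_p) (g : T -> 'Z_p) : w != 0 ->
  all (within ends S) L -> (forall x, P x -> (wt x == w) || (wt x == - w)) ->
  (forall A, A \subset S -> A != set0 -> A != S ->
    (p * 5 - 2 <= cut (map ends (filter P L)) A)%N) ->
  \sum_(v in S) g v = 0 ->
  exists2 b, ach ends wt L b & {in S, b =1 g}.
Proof.
move=> w0 LS Pw cuts g0.
have p1 : (1 < p)%N by apply: leq_trans p_ge3.
have Fp : p%:R = 0 :> 'Z_p by rewrite pchar_Zp.
have Fp0 (z : int) : (p%:Z %| z)%Z <-> z%:~R = 0 :> 'Z_p.
  have chp : p \in [pchar 'Z_p] by rewrite inE p_pr Fp /=.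
  by rewrite (dvdz_pcharf chp); split=> /eqP.
have wu : w \is a GRing.unit.
  rewrite -[w]natr_Zp unitZpE // prime_coprime //; apply/negP => /dvdnP[k wk].
  by case/eqP: w0; rewrite -[w]natr_Zp wk natrM Fp mulr0.
have [b0 b0P] := ach_ex ends wt (filter (predC P) L).
have LcS : all (within ends S) (filter (predC P) L).
  by rewrite all_filter; apply: sub_all LS => x xS; apply/implyP.
have LpS : all (within ends S) (filter P L).
  by rewrite all_filter; apply: sub_all LS => x xS; apply/implyP.
have b00 := ach_sum b0P (all_In LcS).
pose E := map ends (filter P L); pose d v := cut E [set v].
pose n v : nat := val (w^-1 * (g v - b0 v)).
pose l v := par_shift (n v) (d v).
have lZ v : w * (l v)%:~R = g v - b0 v.
  rewrite /l /par_shift -pmulrn natrD natr_Zp.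
  by case: ifP => _; rewrite ?Fp addr0 mulVKr.
have lpar v : odd `|l v|%N = odd (d v).
  rewrite /l /par_shift absz_nat oddD; case: ifP => [/eqP->|]; first by rewrite addbF.
  by rewrite p_odd; case: (odd (n v)); case: (odd (d v)).
have [||||b bP bS] := @orient p T p_ge3 S E l.
- by rewrite /inS all_map.
- exact: cuts.
- by move=> v _; exact: lpar.
(* [2p] divides the sum of the labels: 2 by the handshake identity, and [p] because the targets sum
   to zero and [w] is a unit. *)
- have evl : (2 %| lam l S)%Z.
    have : ~~ odd (\sum_(v in S) d v)%N by rewrite handshake // mul2n odd_double.
    suff -> : odd (\sum_(v in S) d v)%N = odd `|lam l S|%N by clear; lia.
    rewrite /lam; apply: (big_rec2 (fun (s : nat) (t : int) => odd s = odd `|t|%N)) => // v s t _.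
    by have := lpar v; clear; lia.
  have pl : (p%:Z %| lam l S)%Z.
    apply/Fp0/(mulrI wu); rewrite mulr0 rmorph_sum mulr_sumr.
    by under eq_bigr do rewrite lZ; rewrite sumrB g0 b00 subrr.
  rewrite mulnC PoszM Gauss_dvdz ?evl ?pl //.
  by rewrite coprimezE !absz_nat coprime2n p_odd.
have bw : ach ends wt (filter P L) [ffun v => w * (b v)%:~R].
  by apply: ach_scale bP; rewrite all_filter; apply: sub_all LS => x _; apply/implyP/Pw.
exists ([ffun v => w * (b v)%:~R] + b0); first exact: ach_join bw b0P.
move=> v vS; rewrite !ffunE -[RHS](subrK (b0 v)) -lZ; congr (_ * _ + _).
apply/eqP; rewrite -subr_eq0 -rmorphB; apply/eqP/Fp0.
by apply: dvdz_trans (bS v vS); rewrite PoszM dvdz_mulr.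
Qed.

End Weighted.

Lemma ach_orientation (T X : finType) (R : zmodType) (ends : X -> T * T) (wt : X -> R) L b :
  uniq L -> ach ends wt L b ->
  exists o : X -> bool, forall v,
    b v = \sum_(x <- L) (if o x then inc ends wt x v else - inc ends wt x v).
Proof.
elim: L b => [|x L IH] b /=; first by move=> _ ->; exists xpredT => v; rewrite big_nil ffunE.
case/andP=> xL uL [b' /(IH _ uL)[o oE] bE].
have ext c v : \sum_(y <- L) (if (if y == x then c else o y) then inc ends wt y v
    else - inc ends wt y v) = b' v.
  rewrite oE; apply: eq_big_seq => y yL; case: eqP => // yx.
  by rewrite -yx yL in xL.
case: bE => ->.
- by exists (fun y => if y == x then true else o y) => v; rewrite big_cons eqxx ext !ffunE addrC.
- by exists (fun y => if y == x then false else o y) => v; rewrite big_cons eqxx ext !ffunE addrC.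
Qed.

(** * Dense weight classes and induction by contraction *)

Section Contract.
Variables (p : nat) (T : finType) (X : Type) (wt : X -> 'Z_p).
Hypotheses (p_pr : prime p) (p_ge3 : (3 <= p)%N) (wt0 : forall x, wt x != 0).
Implicit Types (ends : X -> T * T) (L : seq X) (A B H S : {set T}) (P : pred X).

(** Loops are left out because they lie in no cut. *)
Definition ec ends L P A :=
  count (fun x => [&& P x, within ends A x & (ends x).1 != (ends x).2]) L.

Lemma ec_split ends L P A H : A \subset H ->
  ec ends L P H = (ec ends L P A + ec ends L P (H :\: A) +
    cut (map ends (filter P (filter (within ends H) L))) A)%N.
Proof.
move=> /subsetP AH; rewrite /ec /cut count_map -filter_predI count_filter.
elim: L => //= x L ->; rewrite /within !inE.
have := AH (ends x).1; have := AH (ends x).2.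
case: (P x) => /=; last by rewrite !andbF.
case: (eqVneq (ends x).1 (ends x).2) => [->|_].
  by rewrite !andbF eqxx.
by do 4!case: (_ \in _) => //=; do ?[move/(_ isT)] => //; clear; lia.
Qed.

Lemma ec_small ends L P A : (#|A| <= 1)%N -> ec ends L P A = 0%N.
Proof.
move/card_le1_eqP => A1; elim: L => //= x L; rewrite /ec /= => ->; rewrite addn0.
case: (boolP (within ends A x)) => [/andP[x1 x2]|]; last by rewrite andbF.
by rewrite (A1 _ _ x1 x2) eqxx !andbF.
Qed.

Definition cl (i : nat) x := (wt x == i.+1%:R) || (wt x == - i.+1%:R).

Lemma cl_exists x : exists2 i, (i < p./2)%N & cl i x.
Proof.
have p1 : (1 < p)%N by exact: ltnW.
have wE : wt x = (val (wt x))%:R by rewrite natr_Zp.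
have wlt : (val (wt x) < p)%N by have := ltn_ord (wt x); rewrite [X in (_ < X)%N](Zp_cast p1).
have wgt : (0 < val (wt x))%N.
  by rewrite lt0n; apply: contraNneq (wt0 x) => w0; rewrite wE w0 mulr0n.
have podd := p_odd p_pr p_ge3.
case: (leqP (val (wt x)) p./2) => wl.
  by exists (val (wt x)).-1; rewrite /cl ?prednK // -wE eqxx.
exists (p - val (wt x)).-1; first by move: wl wlt podd; clear; lia.
rewrite /cl prednK ?subn_gt0 // natrB ?(ltnW wlt) // pchar_Zp // sub0r opprK -wE.
by rewrite eqxx orbT.
Qed.

(** By the handshake identity there are at least [(6p - 8) * #|S| * (p - 1) / 2] edges that are not
    loops, and [(p - 1) / 2] classes. *)
Lemma pigeon ends L S : (0 < #|S|)%N -> all (within ends S) L ->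
  (forall v, v \in S -> ((6 * p - 8) * (p - 1) <= cut (map ends L) [set v])%N) ->
  exists2 i, (i < p./2)%N & ((6 * p - 8) * #|S| <= ec ends L (cl i) S)%N.
Proof.
move=> S0 LS degs.
have podd := p_odd p_pr p_ge3.
have hs := handshake LS.
have deg : (#|S| * ((6 * p - 8) * (p - 1)) <=
    2 * count (fun x => (ends x).1 != (ends x).2) L)%N.
  by rewrite -hs -sum_nat_const leq_sum.
have cov : (count (fun x => (ends x).1 != (ends x).2) L <=
    \sum_(i < p./2) ec ends L (cl i) S)%N.
  rewrite /ec; elim: L LS {deg degs hs} => //= x L IH /andP[xS LS].
  under eq_bigr do rewrite /= xS.
  rewrite big_split /= leq_add ?IH //.
  have [i ip ix] := cl_exists x.
  by rewrite (bigD1 (Ordinal ip)) //= ix leq_addr.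
have [i iP|none] := pickP (fun i : 'I_p./2 => ((6 * p - 8) * #|S| <= ec ends L (cl i) S)%N).
  by exists i.
have up : (\sum_(i < p./2) ec ends L (cl i) S <= p./2 * ((6 * p - 8) * #|S|).-1)%N.
  rewrite -[X in (_ <= X * _)%N](card_ord p./2) -sum_nat_const; apply: leq_sum => i _.
  by have := none i; rewrite leqNgt; move/negbFE; case: (_ * _)%N.
have pE : (p - 1 = 2 * p./2)%N by move: podd p_ge3; clear; lia.
have h0 : (0 < p./2)%N by move: p_ge3; clear; lia.
have D0 : (0 < (6 * p - 8) * #|S|)%N by rewrite muln_gt0 S0 andbT; move: p_ge3; clear; lia.
move: deg cov up; rewrite pE.
rewrite (_ : #|S| * ((6 * p - 8) * (2 * p./2)) = 2 * (p./2 * ((6 * p - 8) * #|S|)))%N; last by ring.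
move: D0; case: ((6 * p - 8) * #|S|)%N => // u _; rewrite /= mulnS.
by move: h0; clear; lia.
Qed.

(** The omitted edges would be loops of the quotient, and a pulled-back set does not split [H]. *)
Lemma cut_pull ends L H a B : a \in H -> B \subset a |: ~: H ->
  cut (map (fun x => (merge H a (ends x).1, merge H a (ends x).2))
        (filter (predC (within ends H)) L)) B = cut (map ends L) (pull H a B).
Proof.
move=> aH BH; rewrite /cut !count_map count_filter; apply: eq_count => x /=.
rewrite !merge_in // /within; case: (boolP (((ends x).1 \in H) && _)) => [/andP[x1 x2]|_]; last by rewrite andbT.
rewrite andbF; apply/esym/negbTE; rewrite negbK /pull; case: ifP => aB; rewrite ?inE ?x1 ?x2 ?orbT //.
have out u : u \in H -> (u \in B) = false.
  move=> uH; apply: contraFF aB => uB; have := subsetP BH _ uB.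
  by rewrite !inE uH orbF => /eqP<-.
by rewrite !out.
Qed.

(* For [p = 3] there is only one class and [6p-7 < 5p-2], so [H = S] is taken. *)
Lemma dense_part ends L S : (1 < #|S|)%N -> all (within ends S) L ->
  (forall A, A \subset S -> A != set0 -> A != S ->
    ((6 * p - 8) * (p - 1) <= cut (map ends L) A)%N) ->
  exists H i, [/\ H \subset S, (1 < #|H|)%N, (i < p./2)%N & forall A,
    A \subset H -> A != set0 -> A != H ->
    (p * 5 - 2 <= cut (map ends (filter (cl i) (filter (within ends H) L))) A)%N].
Proof.
move=> S1 LS cuts.
have degs v : v \in S -> ((6 * p - 8) * (p - 1) <= cut (map ends L) [set v])%N.
  move=> vS; apply: cuts; first by rewrite sub1set.
    by apply/set0Pn; exists v; rewrite set11.
  by apply: contraTneq S1 => <-; rewrite cards1.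
have podd := p_odd p_pr p_ge3.
case: (leqP 4 p) => p4; last first.
  have p3 : p = 3%N by move: p4 p_ge3; clear; lia.
  have h1 : (0 < p./2)%N by rewrite p3.
  exists S, 0%N; split=> // A AS A0 AnS.
  have -> : filter (cl 0) (filter (within ends S) L) = L.
    rewrite -filter_predI; apply/all_filterP; apply: sub_all LS => x /= ->; rewrite andbT.
    have [i ip] := cl_exists x; have -> // : i = 0%N.
    by move: ip; rewrite p3; clear; case: i.
  by apply: leq_trans (cuts A AS A0 AnS); rewrite p3.
have [i ip iS] := pigeon (ltnW S1) LS degs.
pose D := (6 * p - 8)%N.
have D0 : (0 < D)%N by rewrite /D; move: p_ge3; clear; lia.
(* This is [ec > D * (#|A| - 1)] without subtraction; it fails for single vertices. *)
pose dense A := [&& A \subset S, A != set0 & (D * #|A| < ec ends L (cl i) A + D)%N].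
have dS : dense S.
  rewrite /dense subxx -card_gt0 (ltnW S1) /=; apply: leq_ltn_trans iS _.
  by rewrite -[X in (X < _)%N]addn0 ltn_add2l.
case: (arg_minnP (fun A : {set T} => #|A|) dS) => H /and3P[HS H0 dH] minH.
have H1 : (1 < #|H|)%N.
  rewrite ltnNge; apply: contraL dH => H1; rewrite ec_small // add0n -leqNgt.
  by rewrite leq_pmulr // card_gt0.
exists H, i; split=> // A AH A0 AnH.
have sparse B : B \subset H -> B != set0 -> B != H -> (ec ends L (cl i) B + D <= D * #|B|)%N.
  move=> BH B0 BnH; rewrite leqNgt; apply: contraNN BnH => dB.
  by rewrite eqEcard BH minH // /dense (subset_trans BH HS) B0 dB.
have DA : H :\: A != set0.
  by apply: contraNneq AnH => e; rewrite eqEsubset AH -setD_eq0 e eqxx.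
have DnH : H :\: A != H.
  apply: contraNneq A0 => e; apply/eqP; move/setDidPl: e; rewrite disjoint_sym => /setDidPl <-.
  by apply/eqP; rewrite setD_eq0.
(* The cut is [ec H - ec A - ec (H :\: A)], which exceeds [D * (#|H| - 1) - D * (#|A| - 1) - D *
   (#|H :\: A| - 1) = D]. So it is at least [6p - 7], hence at least [5p - 2] for [p >= 5]. *)
have := sparse A AH A0 AnH; have := sparse _ (subsetDl H A) DA DnH.
have cH : #|H| = (#|A| + #|H :\: A|)%N by have := cardsID A H; rewrite (setIidPr AH).
move: dH; rewrite cH mulnDr (ec_split ends L (cl i) AH).
have p5 : (5 <= p)%N by move: p4 podd; clear; lia.
have DE : (p * 5 - 2 <= D + 1)%N by rewrite /D; move: p5; clear; lia.
move: DE; clear; move: (D * _)%N (D * _)%N (ec _ _ _ _) (ec _ _ _ _) (cut _ _) => *; lia.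
Qed.

(** Induction on [#|S|]. Contraction changes only the map [ends] and drops the edges inside [H];
    cuts of the quotient are cuts of the original, so the connectivity persists. *)
Lemma contract_orient ends L S (g : T -> 'Z_p) : S != set0 -> all (within ends S) L ->
  (forall A, A \subset S -> A != set0 -> A != S ->
    ((6 * p - 8) * (p - 1) <= cut (map ends L) A)%N) ->
  \sum_(v in S) g v = 0 ->
  exists2 b, ach ends wt L b & {in S, b =1 g}.
Proof.
elim: {S}_.+1 {-2}S (ltnSn #|S|) ends L g => // n IH S; rewrite ltnS => Sn ends L g S0 LS cuts g0.
case: (leqP #|S| 1) => S1.
  have [b bP] := ach_ex ends wt L; exists b => // v vS.
  have /cards1P[u Su] : #|S| == 1%N by rewrite eqn_leq S1 card_gt0.
  have := ach_sum bP (all_In LS); move: g0 vS.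
  by rewrite Su !big_set1 inE => gu /eqP->; rewrite gu.
have [H [i [HS H1 ip cH]]] := dense_part S1 LS cuts.
have [a aH] : exists a, a \in H by apply/set0Pn; rewrite -card_gt0 ltnW.
pose f := merge H a; pose S' := a |: (S :\: H).
pose ends' x := (f (ends x).1, f (ends x).2).
pose L1 := filter (within ends H) L; pose L2 := filter (predC (within ends H)) L.
have S'H : S' \subset a |: ~: H by exact: sub_merge.
have fS v : v \in S -> f v \in S'.
  by move=> vS; rewrite /f /merge /S' !inE; case: ifP => [|->]; rewrite ?eqxx ?vS ?orbT.
have aS : a \in S by exact: (subsetP HS).
have fib w : w \in S -> w \notin H -> forall v, (f v == w) = (v == w).
  move=> wS wH v; rewrite /f /merge; case: ifP => // vH.
  have -> : (a == w) = false by apply: contraNF wH => /eqP<-.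
  by apply/esym; apply: contraNF wH => /eqP<-.
have fiba v : (f v == a) = (v \in H).
  by rewrite /f /merge; case: ifP => [_|vH]; rewrite ?eqxx //; apply: contraFF vH => /eqP->.
pose g' w := \sum_(v | (v \in S) && (f v == w)) g v.
have [|||||b' b'P b'E] := IH S' _ ends' L2 g'.
- by have := card_merge HS aH; rewrite -/S'; move: Sn H1; clear; lia.
- by apply/set0Pn; exists a; rewrite setU11.
- rewrite all_filter; apply: sub_all LS => x /andP[x1 x2]; apply/implyP => _.
  by rewrite /within /= !fS.
- move=> A AS' A0 AnS'; rewrite (cut_pull ends L aH (subset_trans AS' S'H)).
  have AH := subset_trans AS' S'H.
  apply: cuts; first exact: pull_sub.
    by apply: contraNneq A0 => p0; rewrite -(pullK aH AH) p0 set0I.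
  apply: contraNneq AnS' => pS; apply/eqP.
  by rewrite -(pullK aH AH) pS -[in LHS](pullS HS aH) pullK.
- rewrite -[RHS]g0 /g'; symmetry; apply: partition_big => v; exact: fS.
have [b1 b1P b1E] := ach_quot b'P.
have b1S v : v \in S -> v \notin H -> b1 v = g v.
  move=> vS vH; have := b1E v; rewrite b'E ?inE ?vS ?vH ?orbT // /g'.
  rewrite (eq_bigl (pred1 v)) => [|u]; last first.
    by rewrite fib //=; case: eqVneq => [->|]; rewrite ?vS ?andbF.
  by rewrite big_pred1_eq (eq_bigl (pred1 v)) => [->|u]; rewrite ?big_pred1_eq ?fib.
have b1H : \sum_(v in H) b1 v = \sum_(v in H) g v.
  rewrite -(eq_bigl _ _ fiba) -b1E b'E ?setU11 // /g'; apply: eq_bigl => v.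
  by rewrite fiba; case: (boolP (v \in H)) => vH; rewrite ?andbF // (subsetP HS).
have i0 : i.+1%:R != 0 :> 'Z_p.
  have p1 : (1 < p)%N by exact: ltnW.
  apply/eqP => /(congr1 val); rewrite /= val_Zp_nat // modn_small //.
  by move: ip p_ge3; clear; lia.
(* The target inside [H] is what the lifted orientation leaves over; it sums to zero because the
   quotient is correct at [a]. *)
have [||||b2 b2P b2E] := @weighted_orient p T X wt p_pr p_ge3 ends L1 H (cl i) i.+1%:R
    (fun v => g v - b1 v) i0.
- exact: filter_all.
- by [].
- exact: cH.
- by rewrite sumrB b1H subrr.
exists (b2 + b1); first exact: ach_join b2P b1P.
move=> v vS; rewrite ffunE; case: (boolP (v \in H)) => vH; first by rewrite b2E ?subrK.
by rewrite (ach_out b2P (all_In (filter_all _ L)) vH) add0r b1S.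
Qed.

End Contract.

Theorem theorem7 (p : nat) (V E : finType) (end1 end2 : E -> V)
    (f : E -> 'Z_p) (beta : V -> 'Z_p) :
  prime p -> (3 <= p)%N ->
  loopless end1 end2 ->
  k_edge_connected end1 end2 ((6 * p - 8) * (p - 1))%N ->
  (forall e, f e != 0) ->
  is_boundary beta ->
  exists o : E -> bool, weighted_orientation end1 end2 o f beta.
Proof.
move=> p_pr p_ge3 _ conn f0 beta0.
(* [contract_orient] needs a vertex; without vertices any orientation works. *)
case: (set_0Vmem [set: V]) => [V0|[v0 _]].
  by exists xpredT => v; have := in_setT v; rewrite V0 inE.
pose ends e := (end1 e, end2 e).
have cutE A : cut (map ends (enum E)) A = #|edge_cut end1 end2 A|.
  rewrite /cut count_map -sum1_count big_enum_cond -sum1_card.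
  by apply: eq_bigl => e; rewrite [RHS]inE inE.
have [||||b bP bE] :=
    @contract_orient p V E f p_pr p_ge3 f0 ends (enum E) [set: V] beta.
- by apply/set0Pn; exists v0.
- by apply/allP => e _; rewrite /within !inE.
- by move=> A _ A0 AT; rewrite cutE; apply: conn.
- by rewrite -[RHS]beta0; apply: eq_bigl => v; rewrite inE.
have [o oE] := ach_orientation (enum_uniq E) bP.
exists o => v; rewrite -bE ?inE // oE big_enum /= /partial_f.
rewrite [X in X - _]big_mkcond [X in _ - X]big_mkcond -sumrB.
apply: eq_bigr => e _; rewrite ffunE /tail /Defs.head /= ![v == _]eq_sym.
by case: (o e); case: (end1 e == v); case: (end2 e == v);
   rewrite /= ?mulr1n ?mulr0n ?subrr ?subr0 ?sub0r ?oppr0 ?opprK.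
Qed.
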